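(* Let $P:\{-1,1\}^k\to\{0,1\}$ and $\gamma>0$. Given $\mathcal{I}\sim\mathcal{F}_P(n,p)$, with high probability $$\{x_i^2\le1\}_{i\in[n]}\vdash_{2k}\mathrm{Val}^{\mathrm{poly}}_{\mathcal{I}}(x)\le\bar P+\gamma$$ when $\bar m\ge\frac{2^{O(k)}n^{k/2}\log^5n}{\gamma^2}$.
   Context: An instance $\mathcal{I}$ of CSP$(P)$ on $n$ variables is a multiset of constraints $(c,T)$, $T\in[n]^k$, $c\in\{-1,1\}^k$; $m=|\mathcal{I}|$. $\mathcal{F}_P(n,p)$ includes each of the $2^kn^k$ possible constraints independently with probability $p$; $\bar m=2^kn^kp$. $\bar P=\mathbb{E}_{z}[P(z)]$ for uniform $z\in\{-1,1\}^k$. Writing $P(z)=\sum_{S\subseteq[k]}\widehat P(S)z^S$ (multilinear expansion, $z^S=\prod_{i\in S}z_i$), define the polynomial $\mathrm{Val}^{\mathrm{poly}}_{\mathcal{I}}(x)=\frac1m\sum_{(c,T)\in\mathcal{I}}\sum_{S\subseteq[k]}\widehat P(S)c^Sx_T^S$ where $x_T^S=\prod_{i\in S}x_{T_i}$. SOS proofs: for polynomials $q_1,\dots,q_a,r_1,\dots,r_b,s\in\mathbb{R}[X]$ and $A=\{q_i\ge0\}\cup\{r_j=0\}$, $A\vdash_d s\ge0$ means $s=u_0+\sum_iu_iq_i+\sum_jv_jr_j$ with $u_0,\dots,u_a$ sums of squares of polynomials, $v_j$ arbitrary polynomials, and $\deg u_0,\deg(u_iq_i),\deg(v_jr_j)\le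 d$; constraints $f\le g$ mean $g-f\ge0$. ''With high probability'': probability $1-o(1)$ as $n\to\infty$. $2^{O(k)}$ denotes $2^{Ck}$ for an absolute constant $C$.
   Formalization: The theorem is stated for k ≥ 2: for k = 1 the claim fails, e.g. for P(z) = (1+z)/2, γ = 1/4 and m̄ of order √n·log^5 n, where almost all occurring variables occur once, so the optimum is 1 − o(1) while P̄ = 1/2. *)

(* Defs.v *)
From HB Require Import structures.
From mathcomp Require Import all_boot all_order all_algebra.
From mathcomp Require Import all_classical all_reals all_analysis.
(* The notations of mpoly clash with those of mathcomp-analysis. *)
From mathcomp Require Import -(notations) mpoly.

Set Implicit Arguments.
Unset Strict Implicit.
Unset Printing Implicit Defensive.

Import Order.TTheory GRing.Theory Num.Theory.
Import numFieldNormedType.Exports.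
Local Open Scope ring_scope.

Notation "{ 'mpoly' R [ n ] }" := (mpoly n R)
  (at level 0, R, n at level 2, format "{ 'mpoly'  R [ n ] }").

Section Polynomials.
Variables (R : realType) (n : nat).

Definition mconst (a : R) : {mpoly R[n]} := mpolyC n a.

Definition mvar (i : 'I_n) : {mpoly R[n]} := mpolyX R (mnm1 i).

(* msize is 0 on the zero polynomial and one plus the total degree elsewhere. *)
Definition deg_le (f : {mpoly R[n]}) (d : nat) : Prop := (msize f <= d.+1)%N.

Definition sum_of_squares (f : {mpoly R[n]}) : Prop :=
  exists gs : seq {mpoly R[n]}, f = \sum_(g <- gs) g ^+ 2.

(* {q_i >= 0}_(i : A) U {r_j = 0}_(j : B) |-_d s >= 0 *)
Definition sos_proves (A B : finType) (q : A -> {mpoly R[n]})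
    (r : B -> {mpoly R[n]}) (d : nat) (s : {mpoly R[n]}) : Prop :=
  exists (u0 : {mpoly R[n]}) (u : A -> {mpoly R[n]}) (v : B -> {mpoly R[n]}),
    [/\ sum_of_squares u0,
        forall i, sum_of_squares (u i),
        [/\ deg_le u0 d, forall i, deg_le (u i * q i) d
          & forall j, deg_le (v j * r j) d]
      & s = u0 + \sum_i u i * q i + \sum_j v j * r j].

(* {x_i ^ 2 <= 1}_(i in [n]) |-_d f <= g; the set of equations is empty *)
Definition sos_proves_le_on_box (d : nat) (f g : {mpoly R[n]}) : Prop :=
  sos_proves (fun i : 'I_n => 1 - mvar i ^+ 2)
             (of_void {mpoly R[n]}) d (g - f).

End Polynomials.

(* {-1,1}^k; the boolean b stands for the sign (-1) ^ b. *)
Definition cube (k : nat) : finType := {ffun 'I_k -> bool}.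

Section Fourier.
Variables (R : realType) (k : nat).

(* z ^ S *)
Definition chi (S : {set 'I_k}) (z : cube k) : R := \prod_(i in S) (-1) ^+ z i.

Definition expect_cube (f : cube k -> R) : R := (2 ^+ k)^-1 * \sum_z f z.

Definition mean (P : cube k -> bool) : R := expect_cube (fun z => (P z)%:R).

(* The coefficients of the multilinear expansion of P: see fourier_expansion
   and fourier_unique. *)
Definition fourier (P : cube k -> bool) (S : {set 'I_k}) : R :=
  expect_cube (fun z => (P z)%:R * chi S z).

Lemma chi_sum_sets (w z : cube k) :
  \sum_(S : {set 'I_k}) chi S w * chi S z = (w == z)%:R * 2 ^+ k.
Proof.
transitivity (\prod_(i < k) ((-1) ^+ w i * (-1) ^+ z i + 1) : R).
  rewrite bigA_distr; apply: eq_bigr => S _.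
  by rewrite /chi -big_split /= big_mkcond.
have [->|/eqP nwz] := eqVneq w z.
  rewrite mul1r (eq_bigr (fun=> 2)) ?prodr_const ?card_ord // => i _.
  by rewrite -expr2 sqrr_sign.
have [i nwzi] : exists i, w i != z i.
  by apply/existsP; apply: contra_notT nwz => /existsPn h; apply/ffunP => i; apply/eqP/negbNE/h.
rewrite (bigD1 i) //= mul0r; apply/eqP; rewrite mulf_eq0; apply/orP; left.
by move: nwzi; case: (w i) (z i) => -[] //= _; rewrite ?mulr1 ?mul1r addNr.
Qed.

Lemma chi_sum_cube (S T : {set 'I_k}) :
  \sum_(z : cube k) chi S z * chi T z = (S == T)%:R * 2 ^+ k.
Proof.
pose F i (b : bool) : R :=
  (if i \in S then (-1) ^+ b else 1) * (if i \in T then (-1) ^+ b else 1).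
transitivity (\prod_(i < k) \sum_(b : bool) F i b).
  rewrite bigA_distr_bigA; apply: eq_bigr => z _.
  by rewrite /chi (big_mkcond (mem S)) (big_mkcond (mem T)) -big_split.
have FE i : \sum_(b : bool) F i b = ((i \in S) == (i \in T))%:R * 2.
  by rewrite big_bool /F; case: (i \in S); case: (i \in T);
     rewrite /= ?(expr1, expr0, mulr1, mul1r, mulrNN, mul0r, addNr).
have [eST|/eqP nST] := eqVneq S T.
  rewrite mul1r (eq_bigr (fun=> 2)) ?prodr_const ?card_ord // => i _.
  by rewrite FE eST eqxx mul1r.
have [i nSTi] : exists i, (i \in S) != (i \in T).
  by apply/existsP; apply: contra_notT nST => /existsPn h; apply/setP => i; apply/eqP/negbNE/h.
by rewrite (bigD1 i) //= FE (negbTE nSTi) !mul0r.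
Qed.

Lemma fourier_expansion (P : cube k -> bool) (z : cube k) :
  (P z)%:R = \sum_(S : {set 'I_k}) fourier P S * chi S z.
Proof.
have two0 : (2 ^+ k : R) != 0 by rewrite expf_neq0 // pnatr_eq0.
under eq_bigr => S _ do
  rewrite /fourier /expect_cube -mulrA mulr_suml.
rewrite -mulr_sumr exchange_big /= (bigD1 z) //= [X in _ + X]big1 ?addr0.
  under eq_bigr => S _ do rewrite -mulrA.
  by rewrite -mulr_sumr chi_sum_sets eqxx mul1r mulrC mulfK.
move=> w nwz; under eq_bigr => S _ do rewrite -mulrA.
by rewrite -mulr_sumr chi_sum_sets (negbTE nwz) mul0r mulr0.
Qed.

Lemma fourier_unique (P : cube k -> bool) (a : {set 'I_k} -> R) :
  (forall z, (P z)%:R = \sum_(S : {set 'I_k}) a S * chi S z) ->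
  forall S, a S = fourier P S.
Proof.
have two0 : (2 ^+ k : R) != 0 by rewrite expf_neq0 // pnatr_eq0.
move=> aP S; rewrite /fourier /expect_cube.
under eq_bigr => z _ do rewrite aP mulr_suml.
rewrite exchange_big /= (bigD1 S) //= [X in _ + X]big1 ?addr0.
  under eq_bigr => z _ do rewrite -mulrA.
  by rewrite -mulr_sumr chi_sum_cube eqxx mul1r mulrC mulfK.
move=> T nTS; under eq_bigr => z _ do rewrite -mulrA.
by rewrite -mulr_sumr chi_sum_cube (negbTE nTS) mul0r mulr0.
Qed.

End Fourier.

Section CSP.
Variables (R : realType) (k : nat).

(* (c, T) with c in {-1,1}^k and T in [n]^k; T may repeat variables. *)
Definition constraint (n : nat) : finType := (cube k * {ffun 'I_k -> 'I_n})%type.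

(* A multiset of constraints, as a list whose order is irrelevant. *)
Definition instance (n : nat) := seq (constraint n).

(* The empty instance, where 1/m is undefined, gets the value 0. *)
Definition val_poly (P : cube k -> bool) (n : nat) (I : instance n) : {mpoly R[n]} :=
  ((size I)%:R)^-1 *:
    \sum_(C <- I) \sum_(S : {set 'I_k})
      (fourier R P S * chi R S C.1) *: \prod_(i in S) mvar R (C.2 i).

(* The law of F_P(n,p): every constraint is present at most once, so a sample
   is a subset J of the set of all 2^k n^k constraints. *)
Definition csp_weight (n : nat) (p : R) (J : {set constraint n}) : R :=
  \prod_(C : constraint n) (if C \in J then p else 1 - p).

Definition csp_prob (n : nat) (p : R) (E : instance n -> Prop) : R :=
  \sum_(J : {set constraint n} | `[< E (enum J) >]) csp_weight p J.

(* \bar m *)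
Definition mean_size (n : nat) (p : R) : R := 2 ^+ k * n%:R ^+ k * p.

End CSP.

(* Main.v *)
Require Import Defs.
From HB Require Import structures.
From mathcomp Require Import all_boot all_order all_algebra.
From mathcomp Require Import all_classical all_reals all_analysis.
From mathcomp Require Import -(notations) mpoly.
From mathcomp Require Import ring lra zify.

Set Implicit Arguments.
Unset Strict Implicit.
Unset Printing Implicit Defensive.

Import Order.TTheory GRing.Theory Num.Theory.
Import numFieldNormedType.Exports.
Local Open Scope classical_set_scope.
Local Open Scope ring_scope.

(* For each nonempty S, the part of the value polynomial with Fourier support S is
   sum_T w_T x_T^S, where w_T is the signed number of constraints with scope T.
   If k = 2h, it is the quadratic form of a matrix with entries w_T indexed by the
   two halves of T.  If k = 2h + 1, write it as sum_i v_i g_i; by Cauchy-Schwarz it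
   suffices to bound sum_i g_i^2, which up to its diagonal is the quadratic form of
   a matrix with entries w_T w_T' indexed by pairs of halves.
   Such a symmetric matrix X is odd in the sign of each w_a.  Exchanging X with its
   flip at a gives E tr X^(2q+2) <= C q s E tr X^(2q) as soon as the flip
   differences H_a have sum_a H_a^2 <= s, and Schur's test bounds s by row sums of
   multiplicities.  These are controlled by an exponential moment bound for sums
   with predictable coefficients.  The bound tr X^(2^(r+1)) <= l^(2^(r+1)) yields
   sum-of-squares certificates for l |z|^2 -+ z^T X z by repeated use of
   2l (l |z|^2 - z^T X z) = |l z - X z|^2 + (l^2 |z|^2 - z^T X^2 z).  Finally 2^r
   is taken of order log n. *)

(** * Certificates on the box *)

(** Conditioning on good instances must not spoil the sign symmetry, so goodness is expressed
    through scope multiplicities alone, which flips preserve. For k odd the entries w_T w_T' share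
    weights, so the matrix is no sum of independent terms; the exchange argument only asks that the
    half differences satisfy sum_a H_a = D X, where D is the number of weights in an entry, 1 for k
    even and 2 for k odd. A row sum for k odd counts pairs of constraints, a quadratic statistic.
    Enumerating the constraints and charging each pair to its later member makes it a linear sum
    with predictable coefficients. The scale is Delta = m-bar / n^(k/2). Up to constants, rows and
    single flips are bounded by Delta and 1 for k even, by Delta^2 and Delta for k odd, while the
    norm allowed is Delta, respectively Delta^2. Either way a moment step gains a factor of order
    log n / Delta: one logarithm makes it small, and the others absorb the constants depending on k
    and gamma. Scopes may repeat variables, since monomials enter only through the fact that their
    squares are at most 1. *)

Lemma size_index_enum_ord h : size (index_enum 'I_h) = h.
Proof. by rewrite [index_enum _]unlock -enumT size_enum_ord. Qed.

Section BoxCone.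
Variables (R : realType) (n : nat).
Implicit Types (f g h : {mpoly R[n]}) (d e : nat).

Lemma deg_leW d e f : (d <= e)%N -> deg_le f d -> deg_le f e.
Proof. by move=> de /leq_trans; apply. Qed.

Lemma deg_le0 d : deg_le (0 : {mpoly R[n]}) d.
Proof. by rewrite /deg_le msize0. Qed.

Lemma deg_leC d (a : R) : deg_le (mconst n a) d.
Proof. by rewrite /deg_le msizeC; case: eqP. Qed.

Lemma deg_leV d i : (0 < d)%N -> deg_le (mvar R i : {mpoly R[n]}) d.
Proof. by move=> d0; rewrite /deg_le msizeX mdeg1. Qed.

Lemma deg_leD d f g : deg_le f d -> deg_le g d -> deg_le (f + g) d.
Proof.
by move=> fd gd; apply: leq_trans (msizeD_le _ _) _; rewrite geq_max fd.
Qed.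

Lemma deg_leN d f : deg_le f d -> deg_le (- f) d.
Proof. by rewrite /deg_le msizeN. Qed.

Lemma deg_leZ d (a : R) f : deg_le f d -> deg_le (a *: f) d.
Proof. exact/leq_trans/msizeZ_le. Qed.

Lemma deg_le_sum d (I : Type) (r : seq I) (P : pred I) (F : I -> {mpoly R[n]}) :
  (forall i, P i -> deg_le (F i) d) -> deg_le (\sum_(i <- r | P i) F i) d.
Proof. by move=> Fd; elim/big_ind: _ => //; [exact: deg_le0|exact: deg_leD]. Qed.

Lemma deg_leM d e f g : deg_le f d -> deg_le g e -> deg_le (f * g) (d + e).
Proof.
have [->|f0] := eqVneq f 0; first by rewrite mul0r => *; exact: deg_le0.
have [->|g0] := eqVneq g 0; first by rewrite mulr0 => *; exact: deg_le0.
rewrite /deg_le msizeM // => fd ge.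
by move: (leq_add fd ge); case: (msize f + msize g)%N => //= m; lia.
Qed.

Lemma deg_le_prod (I : Type) (r : seq I) (F : I -> {mpoly R[n]}) :
  (forall i, deg_le (F i) 1) -> deg_le (\prod_(i <- r) F i) (size r).
Proof.
move=> F1; elim: r => [|i r IHr]; first by rewrite big_nil; exact: (deg_leC _ 1).
by rewrite big_cons /= -add1n; apply: deg_leM.
Qed.

Lemma sum_of_squares0 : sum_of_squares (0 : {mpoly R[n]}).
Proof. by exists [::]; rewrite big_nil. Qed.

Lemma sum_of_squaresD f g :
  sum_of_squares f -> sum_of_squares g -> sum_of_squares (f + g).
Proof. by move=> [s ->] [t ->]; exists (s ++ t); rewrite big_cat. Qed.

Lemma sum_of_squares_sqr f : sum_of_squares (f ^+ 2).
Proof. by exists [:: f]; rewrite big_seq1. Qed.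

Lemma sum_of_squaresZ (a : R) f :
  0 <= a -> sum_of_squares f -> sum_of_squares (a *: f).
Proof.
move=> a0 [s ->]; exists [seq Num.sqrt a *: g | g <- s].
rewrite big_map scaler_sumr; apply: eq_bigr => g _.
by rewrite exprZn sqr_sqrtr.
Qed.

(** Every inequality below is stated as membership in this convex cone, so certificates are added
    and scaled without exhibiting their multipliers. *)
Definition box_cone d f : Prop :=
  sos_proves (fun i : 'I_n => 1 - mvar R i ^+ 2) (of_void {mpoly R[n]}) d f.

Lemma box_cone0 d : box_cone d 0.
Proof.
exists 0, (fun=> 0), (fun=> 0); split => //; try by move=> *; exact: sum_of_squares0.
  by split=> *; rewrite ?mul0r; exact: deg_le0.
by rewrite !big1 ?addr0// => i _; rewrite mul0r.
Qed.

Lemma box_coneD d f g : box_cone d f -> box_cone d g -> box_cone d (f + g).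
Proof.
move=> [u0 [u [v [su0 su [du0 du dv] ->]]]] [w0 [w [v' [sw0 sw [dw0 dw dv'] ->]]]].
exists (u0 + w0), (fun i => u i + w i), (fun=> 0); split.
- exact: sum_of_squaresD.
- by move=> i; apply: sum_of_squaresD.
- split; [exact: deg_leD|move=> i; rewrite mulrDl; exact: deg_leD|by case].
- rewrite !(big_pred0 _ _ _ (P := fun _ : void => true)); try by case.
  rewrite !addr0 addrACA -big_split /=; congr (_ + _).
  by apply: eq_bigr => i _; rewrite mulrDl.
Qed.

Lemma box_coneZ d (a : R) f : 0 <= a -> box_cone d f -> box_cone d (a *: f).
Proof.
move=> a0 [u0 [u [v [su0 su [du0 du dv] ->]]]].
exists (a *: u0), (fun i => a *: u i), (fun=> 0); split.
- exact: sum_of_squaresZ.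
- by move=> i; apply: sum_of_squaresZ.
- split; [exact: deg_leZ|move=> i; rewrite -scalerAl; exact: deg_leZ|by case].
- rewrite !(big_pred0 _ _ _ (P := fun _ : void => true)); try by case.
  rewrite !addr0 scalerDr scaler_sumr; congr (_ + _).
  by apply: eq_bigr => i _; rewrite scalerAl.
Qed.

Lemma box_cone_sum d (I : Type) (r : seq I) (P : pred I) (F : I -> {mpoly R[n]}) :
  (forall i, P i -> box_cone d (F i)) -> box_cone d (\sum_(i <- r | P i) F i).
Proof. by move=> Fd; elim/big_ind: _ => //; [exact: box_cone0|exact: box_coneD]. Qed.

Lemma box_cone_sqr d e f : (e.*2 <= d)%N -> deg_le f e -> box_cone d (f ^+ 2).
Proof.
move=> ed fe; exists (f ^+ 2), (fun=> 0), (fun=> 0); split.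
- exact: sum_of_squares_sqr.
- by move=> *; exact: sum_of_squares0.
- split; [|by move=> i; rewrite mul0r; exact: deg_le0|by case].
  by apply: deg_leW ed _; rewrite -addnn expr2; exact: deg_leM.
- by rewrite !big1 ?addr0// => i _; rewrite mul0r.
Qed.

Lemma box_coneC d (a : R) : 0 <= a -> box_cone d (mconst n a).
Proof.
move=> a0; have -> : mconst n a = a *: 1 ^+ 2.
  by rewrite expr1n /mconst alg_mpolyC.
by apply: box_coneZ => //; apply: (@box_cone_sqr _ 0) => //; exact: (deg_leC _ 1).
Qed.

Lemma box_cone_box d e f i : (e.+1.*2 <= d)%N -> deg_le f e ->
  box_cone d (f ^+ 2 * (1 - mvar R i ^+ 2)).
Proof.
move=> ed fe; exists 0, (fun j => if j == i then f ^+ 2 else 0), (fun=> 0); split.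
- exact: sum_of_squares0.
- by move=> j; case: eqP => _; [exact: sum_of_squares_sqr|exact: sum_of_squares0].
- split; [exact: deg_le0| |by case].
  move=> j; case: eqP => _; last by rewrite mul0r; exact: deg_le0.
  rewrite [f ^+ 2]expr2.
  apply: (@deg_leW (e + e + 2)); first by move: ed; lia.
  apply: deg_leM.
    exact: deg_leM.
  apply: deg_leD; first exact: (deg_leC _ 1).
  by apply/deg_leN; rewrite expr2 -addn1; apply: deg_leM; exact: deg_leV.
- rewrite add0r (big_pred0 _ _ _ (P := fun _ : void => true)); last by case.
  by rewrite addr0 (bigD1 i) //= eqxx big1 ?addr0 // => j /negPf ->; rewrite mul0r.
Qed.

Definition box_var (f : {mpoly R[n]}) := f = 1 \/ exists i, f = mvar R i.

Lemma box_var_deg f : box_var f -> deg_le f 1.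
Proof. by case=> [->|[i ->]]; [exact: (deg_leC _ 1)|exact: deg_leV]. Qed.

(** Peeling off one factor leaves the square of the remaining monomial times a box constraint, so
    each factor adds 2 to the degree. *)
Lemma box_cone_prod d (I : Type) (r : seq I) (F : I -> {mpoly R[n]}) :
  ((size r).*2 <= d)%N -> (forall i, box_var (F i)) ->
  box_cone d (1 - (\prod_(i <- r) F i) ^+ 2).
Proof.
move=> + Fv; elim: r => [|i r IHr] rd.
  by rewrite big_nil expr1n subrr; exact: box_cone0.
rewrite big_cons.
set m := \prod_(j <- r) F j.
have -> : 1 - (F i * m) ^+ 2 = (1 - m ^+ 2) + m ^+ 2 * (1 - F i ^+ 2) by ring.
apply: box_coneD; first by apply: IHr; move: rd => /=; lia.
case: (Fv i) => [->|[j ->]]; first by rewrite expr1n subrr mulr0; exact: box_cone0.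
apply: box_cone_box rd _; apply: deg_le_prod => l; exact: box_var_deg.
Qed.

End BoxCone.

(** * Trace inequalities *)

Section TraceInequalities.
Variables (R : realType) (N : nat).
Implicit Types (A B H P Q : 'M[R]_N).

Definition symmetric_mx A := A^T = A.

Lemma mulmx_exp A a b : A ^+ a *m A ^+ b = A ^+ (a + b).
Proof. by rewrite exprD. Qed.

Lemma symmetric_exp A m : symmetric_mx A -> symmetric_mx (A ^+ m).
Proof.
move=> sA; rewrite /symmetric_mx; elim: m => [|m IHm]; first by rewrite expr0 trmx1.
by rewrite exprS trmx_mul IHm sA -[_ *m _]/(A ^+ m * A) -exprSr -exprS.
Qed.

Lemma trace_gram (m : nat) (P : 'M[R]_(N, m)) :
  \tr (P *m P^T) = \sum_i \sum_j P i j ^+ 2.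
Proof.
by apply: eq_bigr => i _; rewrite mxE; apply: eq_bigr => j _; rewrite mxE -expr2.
Qed.

Lemma trace_gram_ge0 P : 0 <= \tr (P *m P^T).
Proof. by rewrite trace_gram; do 2!apply: sumr_ge0 => ? _; exact: sqr_ge0. Qed.

Lemma trace_cauchy P Q : 2 * \tr (P *m Q^T) <= \tr (P *m P^T) + \tr (Q *m Q^T).
Proof.
have := trace_gram_ge0 (P - Q).
have -> : \tr ((P - Q) *m (P - Q)^T)
        = \tr (P *m P^T) + \tr (Q *m Q^T) - 2 * \tr (P *m Q^T).
  rewrite linearB /= mulmxBl !mulmxBr !linearB /=.
  by rewrite -[\tr (Q *m P^T)]mxtrace_tr trmx_mul trmxK; ring.
by rewrite subr_ge0.
Qed.

Lemma trace_pow_even_ge0 A m : symmetric_mx A -> 0 <= \tr (A ^+ m.*2).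
Proof.
move=> sA; rewrite -addnn -mulmx_exp -{2}(symmetric_exp m sA).
exact: trace_gram_ge0.
Qed.

(** If [g] rises after [a] it keeps rising up to [M]; otherwise it has been falling since [0].
    Nonnegativity turns the larger end value into the sum of both. *)
Lemma convex_seq_le (g : nat -> R) (M : nat) :
  (forall a, (a <= M)%N -> 0 <= g a) ->
  (forall a, (a.+2 <= M)%N -> 2 * g a.+1 <= g a + g a.+2) ->
  forall a, (a <= M)%N -> g a <= g 0%N + g M.
Proof.
move=> g0 cvx a aM; have [inc|dec] := boolP ((a < M)%N && (g a <= g a.+1)).
  have [ltaM le1] := andP inc.
  have step b : (a <= b)%N -> (b < M)%N -> g b <= g b.+1.
    elim: b => [|b IHb]; first by rewrite leqn0 => /eqP <-.
    rewrite leq_eqVlt => /predU1P[<- //|]; rewrite ltnS => ab bM.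
    have := cvx b bM; have := IHb ab (ltnW bM); lra.
  have mono b : (a <= b)%N -> (b <= M)%N -> g a <= g b.
    elim: b => [|b IHb]; first by rewrite leqn0 => /eqP <-.
    rewrite leq_eqVlt => /predU1P[<- //|]; rewrite ltnS => ab bM.
    exact: le_trans (IHb ab (ltnW bM)) (step b ab bM).
  by apply: ler_wpDl (g0 _ _) (mono M aM _).
have [->|aNM] := eqVneq a M; first by apply: ler_wpDl => //; exact: g0.
have ltaM : (a < M)%N by rewrite ltn_neqAle aNM.
move: dec; rewrite ltaM /= -ltNge => dec.
have step b : (b <= a)%N -> g (a - b).+1 <= g (a - b)%N.
  elim: b => [|b IHb]; first by rewrite subn0 ltW.
  move=> ba; have := IHb (ltnW ba); have := cvx (a - b.+1)%N.
  by rewrite subnSK // => /(_ _) le1 le2; have := le1 ltac:(lia); lra.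
have mono b : (b <= a)%N -> g a <= g (a - b)%N.
  elim: b => [|b IHb]; first by rewrite subn0.
  move=> ba; apply: le_trans (IHb (ltnW ba)) _.
  by have := step b.+1 ba; rewrite subnSK.
by apply: ler_wpDr (g0 M _) _ => //; have := mono a (leqnn a); rewrite subnn.
Qed.

(* With [g a = tr (H A^(2a) H B^(2(M-a))) >= 0], Cauchy-Schwarz for the trace
   gives [2 tr (H A^(a+a') H B^(...)) <= g a + g a'], whence also convexity of [g]. *)
Lemma trace_interlaced H A B M r :
  symmetric_mx H -> symmetric_mx A -> symmetric_mx B -> (r <= M.*2)%N ->
  \tr (H *m A ^+ r *m H *m B ^+ (M.*2 - r)) <=
    \tr (H *m H *m A ^+ M.*2) + \tr (H *m H *m B ^+ M.*2).
Proof.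
move=> sH sA sB rM.
pose F a := A ^+ a *m H *m B ^+ (M - a).
(* By cyclicity the trace depends on [a + b] only, so Cauchy-Schwarz between [a] and [a + 2] is the
   convexity of [g] at [a + 1]. *)
have FE a b : (a <= M)%N -> (b <= M)%N ->
    \tr (F a *m (F b)^T) = \tr (H *m A ^+ (a + b) *m H *m B ^+ (M.*2 - (a + b))).
  move=> aM bM; rewrite /F !trmx_mul sH !(symmetric_exp _ sA, symmetric_exp _ sB).
  rewrite -!mulmxA (mulmxA (B ^+ _) (B ^+ _)) mulmx_exp.
  have -> : (M - a + (M - b) = M.*2 - (a + b))%N by lia.
  rewrite mxtrace_mulC -!mulmxA mulmx_exp addnC mulmxA mxtrace_mulC.
  by rewrite -!mulmxA.
pose g a := \tr (F a *m (F a)^T).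
have g0 a : (a <= M)%N -> 0 <= g a by move=> _; exact: trace_gram_ge0.
have cvx a : (a.+2 <= M)%N -> 2 * g a.+1 <= g a + g a.+2.
  move=> aM; rewrite {1}/g FE; try lia.
  have -> : (a.+1 + a.+1 = a + a.+2)%N by lia.
  by rewrite -FE; try lia; exact: trace_cauchy.
have gle a : (a <= M)%N -> g a <= g 0%N + g M by apply: convex_seq_le.
(* An odd [r] falls between two values of [g]; Cauchy-Schwarz then compares its two neighbouring
   halves. *)
have -> : (r = r./2 + uphalf r)%N by rewrite uphalf_half addnCA addnn odd_double_half.
have hM : (r./2 <= M)%N by lia.
have uM : (uphalf r <= M)%N by rewrite uphalf_half; lia.
have g0E : g 0%N = \tr (H *m H *m B ^+ M.*2).
  by rewrite /g FE // addn0 subn0 expr0 mulmx1.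
have gME : g M = \tr (H *m H *m A ^+ M.*2).
  rewrite /g FE // addnn subnn expr0 mulmx1 mxtrace_mulC mulmxA.
  by [].
rewrite -FE //; have := trace_cauchy (F r./2) (F (uphalf r)).
by have := gle _ hM; have := gle _ uM; rewrite g0E gME /g; lra.
Qed.

Lemma subrXX_noncomm A B m :
  A ^+ m - B ^+ m = \sum_(r < m) A ^+ r *m (A - B) *m B ^+ (m.-1 - r).
Proof.
elim: m => [|m IHm]; first by rewrite big_ord0 !expr0 subrr.
rewrite big_ord_recr /= subnn expr0 mulmx1.
have -> : A ^+ m.+1 - B ^+ m.+1 = (A ^+ m - B ^+ m) *m B + A ^+ m *m (A - B).
  rewrite -[_ *m B]/((A ^+ m - B ^+ m) * B) -[_ *m (A - B)]/(A ^+ m * (A - B)).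
  by rewrite mulrBl mulrBr !exprSr [RHS]addrC addrA subrK.
congr (_ + _); rewrite IHm mulmx_suml; apply: eq_bigr => r _.
rewrite -!mulmxA; congr (_ *m (_ *m _)).
by rewrite -{2}[B]expr1 mulmx_exp; congr (_ ^+ _); case: r => r /=; lia.
Qed.

(** As [A - B] is itself a multiple of [H], each of the [2M + 1] telescoping terms is an interlaced
    trace with the same [H] in both slots. *)
Lemma trace_pow_diff H A B M :
  symmetric_mx H -> symmetric_mx A -> symmetric_mx B -> A - B = 2 *: H ->
  \tr (H *m (A ^+ M.*2.+1 - B ^+ M.*2.+1)) <=
    2 * M.*2.+1%:R * (\tr (H *m H *m A ^+ M.*2) + \tr (H *m H *m B ^+ M.*2)).
Proof.
move=> sH sA sB AB; rewrite subrXX_noncomm /= mulmx_sumr raddf_sum /=.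
have le1 (r : 'I_M.*2.+1) : \tr (H *m (A ^+ r *m (A - B) *m B ^+ (M.*2 - r))) <=
    2 * (\tr (H *m H *m A ^+ M.*2) + \tr (H *m H *m B ^+ M.*2)).
  rewrite AB -scalemxAr -!scalemxAl -scalemxAr linearZ /= ler_pM2l //.
  by rewrite !mulmxA trace_interlaced // -ltnS.
apply: le_trans (ler_sum _ (fun r _ => le1 r)) _.
by rewrite sumr_const card_ord -[leLHS]mulr_natr mulrAC.
Qed.

(** Both sides are double sums; once the right one is symmetrised they compare termwise by
    [2 |z_i z_j| <= z_i^2 + z_j^2]. *)
Lemma weighted_cauchy (h z : 'I_N -> R) :
  (\sum_j h j * z j) ^+ 2 <= (\sum_j `|h j|) * \sum_j `|h j| * z j ^+ 2.
Proof.
rewrite expr2 !big_distrlr /=.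
rewrite -(ler_pM2l (_ : 0 < 2 :> R)) // !mulr_sumr.
pose T i j := `|h i| * `|h j| * (z i ^+ 2 + z j ^+ 2).
have RE : \sum_i 2 * \sum_j `|h i| * (`|h j| * z j ^+ 2) = \sum_i \sum_j T i j.
  rewrite -mulr_sumr mulr_natl mulr2n {1}exchange_big -big_split /=.
  apply: eq_bigr => i _; rewrite -big_split /=; apply: eq_bigr => j _.
  by rewrite /T; ring.
rewrite RE; apply: ler_sum => i _; rewrite mulr_sumr; apply: ler_sum => j _.
rewrite /T -normrM.
have -> : 2 * (h i * z i * (h j * z j)) = (h i * h j) * (2 * (z i * z j)) by ring.
apply: le_trans (ler_norm _) _; rewrite (normrM (h i * h j)); apply: ler_wpM2l => //.
rewrite ler_norml; have := sqr_ge0 (z i + z j); have := sqr_ge0 (z i - z j).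
rewrite !expr2; nra.
Qed.

(* Schur's test: each entry of [H_a Z] is estimated by Cauchy-Schwarz against
   the row of [|H_a|]. *)
Lemma trace_schur (I : finType) (H : I -> 'M[R]_N) (X : 'M[R]_N) (M : nat) (r1 r2 : R) :
  symmetric_mx X -> (forall a, symmetric_mx (H a)) ->
  (forall a i, \sum_j `|H a i j| <= r2) ->
  (forall i, \sum_a \sum_j `|H a i j| <= r1) -> 0 <= r2 ->
  \sum_a \tr (H a *m H a *m X ^+ M.*2) <= r1 * r2 * \tr (X ^+ M.*2).
Proof.
move=> sX sH rH r1H r20; pose Z := X ^+ M.
have ZE : X ^+ M.*2 = Z *m Z^T.
  by rewrite /Z (symmetric_exp M sX) -addnn mulmx_exp.
have trE a : \tr (H a *m H a *m X ^+ M.*2) = \sum_i \sum_c (H a *m Z) i c ^+ 2.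
  by rewrite -trace_gram trmx_mul (sH a) ZE mxtrace_mulC !mulmxA mxtrace_mulC !mulmxA.
have le1 a i c : (H a *m Z) i c ^+ 2 <= r2 * \sum_j `|H a i j| * Z j c ^+ 2.
  rewrite mxE; apply: le_trans (weighted_cauchy _ _) _.
  apply: ler_wpM2r => //; apply: sumr_ge0 => j _; rewrite mulr_ge0 ?sqr_ge0 //.
have HN a i j : `|H a i j| = `|H a j i| by rewrite -{1}(sH a) mxE.
apply: (@le_trans _ _ (\sum_a \sum_i \sum_c r2 * \sum_j `|H a i j| * Z j c ^+ 2)).
  by apply: ler_sum => a _; rewrite trE; do 2!apply: ler_sum => ? _.
rewrite ZE trace_gram.
(* Summing over the row index first exposes column sums of [|H_a|]; by symmetry these are the row
   sums bounded by [r1]. *)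
have -> : \sum_a \sum_i \sum_c r2 * \sum_j `|H a i j| * Z j c ^+ 2
   = r2 * \sum_j (\sum_a \sum_i `|H a j i|) * \sum_c Z j c ^+ 2.
  under eq_bigr => a _ do under eq_bigr => i _ do rewrite -mulr_sumr.
  under eq_bigr => a _ do rewrite -mulr_sumr.
  rewrite -mulr_sumr; congr (_ * _).
  under eq_bigr => a _ do under eq_bigr => i _ do rewrite exchange_big /=.
  under eq_bigr => a _ do rewrite exchange_big /=.
  rewrite exchange_big /=; apply: eq_bigr => j _; rewrite mulr_suml.
  apply: eq_bigr => a _; rewrite mulr_suml; apply: eq_bigr => i _.
  by rewrite mulr_sumr HN.
rewrite (mulrC r1) -[leRHS]mulrA; apply: ler_wpM2l => //.
rewrite mulr_sumr; apply: ler_sum => j _; apply: ler_wpM2r => //.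
by apply: sumr_ge0 => c _; exact: sqr_ge0.
Qed.

End TraceInequalities.

(** * Moments of flip-symmetric random matrices *)

Section MomentMethod.
Variables (R : realType) (Omega A : finType).
Variables (W : Omega -> R) (phi : A -> Omega -> Omega).
Hypotheses (W_ge0 : forall w, 0 <= W w) (phiK : forall a, involutive (phi a)).
Hypothesis W_phi : forall a w, W (phi a w) = W w.

Lemma sum_flip a (f : Omega -> R) :
  \sum_w W w * f (phi a w) = \sum_w W w * f w.
Proof.
rewrite (reindex_inj (inv_inj (phiK a))) /=; apply: eq_bigr => w _.
by rewrite W_phi phiK.
Qed.

Section TraceMoments.
Variables (N : nat) (X : Omega -> 'M[R]_N) (D r1 r2 : R).
(** The part of [X] that is odd under the flip at [a]. The hypothesis [X_eigen] expresses that [X]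
    is homogeneous of degree [D] in the signs. The weight [W] is not normalised, so that it can be a
    law restricted to an event; the row bounds are asked only on its support. *)
Let H a w := 2^-1 *: (X w - X (phi a w)).
Hypotheses (X_sym : forall w, symmetric_mx (X w)) (D_gt0 : 0 < D).
Hypothesis X_eigen : forall w, \sum_a H a w = D *: X w.
Hypothesis H_row : forall w a i, W w != 0 -> \sum_j `|H a w i j| <= r2.
Hypothesis H_rows : forall w i, W w != 0 -> \sum_a \sum_j `|H a w i j| <= D * r1.
Hypotheses (r1_ge0 : 0 <= r1) (r2_ge0 : 0 <= r2).

Lemma H_sym a w : symmetric_mx (H a w).
Proof. by rewrite /symmetric_mx /H linearZ linearB /= !X_sym. Qed.

(* Exchanging [w] and [phi a w] turns [D E tr X^(2M+2) = sum_a E tr (H_a X^(2M+1))]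
   into a sum of the differences bounded in [trace_pow_diff]. *)
Lemma moment_step M :
  \sum_w W w * \tr (X w ^+ M.+1.*2) <=
    4 * M.+1%:R * (r1 * r2) * \sum_w W w * \tr (X w ^+ M.*2).
Proof.
pose T a w := \tr (H a w *m H a w *m X w ^+ M.*2).
have HN a w : H a (phi a w) = - H a w.
  by rewrite /H phiK -scalerN opprB.
have stepA a : \sum_w W w * \tr (H a w *m X w ^+ M.*2.+1) <=
    2 * M.*2.+1%:R * \sum_w W w * T a w.
  pose f w := \tr (H a w *m X w ^+ M.*2.+1).
  have fE : \sum_w W w * f w = - \sum_w W w * \tr (H a w *m X (phi a w) ^+ M.*2.+1).
    rewrite -(sum_flip a f) -sumrN; apply: eq_bigr => w _.
    by rewrite /f HN mulNmx linearN /= mulrN.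
  have TE : \sum_w W w * T a w
          = \sum_w W w * \tr (H a w *m H a w *m X (phi a w) ^+ M.*2).
    rewrite -(sum_flip a (T a)); apply: eq_bigr => w _.
    by rewrite /T HN mulNmx mulmxN opprK.
  have le1 : \sum_w W w * \tr (H a w *m (X w ^+ M.*2.+1 - X (phi a w) ^+ M.*2.+1))
      <= 2 * M.*2.+1%:R * (\sum_w W w * T a w +
         \sum_w W w * \tr (H a w *m H a w *m X (phi a w) ^+ M.*2)).
    rewrite -big_split mulr_sumr; apply: ler_sum => w _ /=.
    rewrite -mulrDr mulrCA; apply: ler_wpM2l => //.
    apply: trace_pow_diff; rewrite ?X_sym //; first exact: H_sym.
    by rewrite /H scalerA mulfV ?scale1r // pnatr_eq0.
  have le1E : \sum_w W w * \tr (H a w *m (X w ^+ M.*2.+1 - X (phi a w) ^+ M.*2.+1))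
      = 2 * \sum_w W w * f w.
    rewrite mulr_natl mulr2n {2}fE -sumrB; apply: eq_bigr => w _.
    by rewrite mulmxBr linearB /= mulrBr.
  move: le1; rewrite le1E -TE /f; lra.
have sumH : D * \sum_w W w * \tr (X w ^+ M.+1.*2)
          = \sum_a \sum_w W w * \tr (H a w *m X w ^+ M.*2.+1).
  rewrite exchange_big mulr_sumr /=; apply: eq_bigr => w _.
  rewrite -mulr_sumr mulrCA; congr (_ * _).
  transitivity (\tr ((\sum_a H a w) *m X w ^+ M.*2.+1)).
    by rewrite X_eigen -scalemxAl mxtraceZ doubleS [X w ^+ M.*2.+2]exprS.
  by rewrite mulmx_suml raddf_sum.
have schur : \sum_a \sum_w W w * T a w <= D * r1 * r2 * \sum_w W w * \tr (X w ^+ M.*2).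
  rewrite exchange_big mulr_sumr /=; apply: ler_sum => w _.
  rewrite -mulr_sumr mulrCA; have [->|W0] := eqVneq (W w) 0; first by rewrite !mul0r.
  apply: ler_wpM2l => //; apply: trace_schur => //.
  - by move=> a; exact: H_sym.
  - by move=> a i; exact: H_row.
  - by move=> i; exact: H_rows.
rewrite -(ler_pM2l D_gt0) sumH.
apply: le_trans (ler_sum _ (fun a _ => stepA a)) _.
rewrite -mulr_sumr.
apply: (@le_trans _ _ (2 * M.*2.+1%:R * (D * r1 * r2 * \sum_w W w * \tr (X w ^+ M.*2)))).
  by apply: ler_wpM2l; rewrite ?mulr_ge0.
set S := \sum_w _.
have S0 : 0 <= S by apply: sumr_ge0 => w _; rewrite mulr_ge0 ?trace_pow_even_ge0.
have -> : D * (4 * M.+1%:R * (r1 * r2) * S) = (4 * M.+1%:R) * (D * r1 * r2 * S) by ring.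
apply: ler_wpM2r; first by rewrite !mulr_ge0 // ltW.
by rewrite -!natrM ler_nat; lia.
Qed.

(** Capping the exponent at [q] lets one factor serve every step; the recursion starts from the
    trace of the identity, which is the dimension. *)
Lemma moment_bound q M : (M <= q)%N ->
  \sum_w W w * \tr (X w ^+ M.*2) <=
    (4 * q%:R * (r1 * r2)) ^+ M * (N%:R * \sum_w W w).
Proof.
elim: M => [|M IHM] Mq.
  rewrite expr0 mul1r mulr_sumr; apply: ler_sum => w _.
  by rewrite expr0 mxtrace1 mulrC.
apply: le_trans (moment_step M) _; rewrite exprS -[leRHS]mulrA.
have r0 : 0 <= r1 * r2 by exact: mulr_ge0.
have S0 m : 0 <= \sum_w W w * \tr (X w ^+ m.*2).
  by apply: sumr_ge0 => w _; rewrite mulr_ge0 ?trace_pow_even_ge0.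
apply: ler_pM; [by rewrite !mulr_ge0|exact: S0| |exact: IHM (ltnW Mq)].
by apply: ler_wpM2r => //; apply: ler_wpM2l => //; rewrite ler_nat.
Qed.

Lemma trace_tail q (lambda : R) : 0 < lambda ->
  \sum_(w | lambda ^+ q.*2 < \tr (X w ^+ q.*2)) W w <=
    (4 * q%:R * (r1 * r2) / lambda ^+ 2) ^+ q * (N%:R * \sum_w W w).
Proof.
move=> l0; have l1 : 0 < lambda ^+ q.*2 by rewrite exprn_gt0.
rewrite -(ler_pM2l l1).
have -> : lambda ^+ q.*2 * ((4 * q%:R * (r1 * r2) / lambda ^+ 2) ^+ q * (N%:R * \sum_w W w))
   = (4 * q%:R * (r1 * r2)) ^+ q * (N%:R * \sum_w W w).
  rewrite -muln2 mulnC exprM mulrA -exprMn; congr (_ ^+ _ * _).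
  by rewrite mulrC mulfVK // expf_neq0 // gt_eqF.
apply: le_trans (moment_bound (leqnn q)).
rewrite mulr_sumr big_mkcond /=; apply: ler_sum => w _; case: ifP => [lw|_].
  by rewrite mulrC; apply: ler_wpM2l => //; exact: ltW.
by rewrite mulr_ge0 ?trace_pow_even_ge0.
Qed.

End TraceMoments.
End MomentMethod.

(** * Symmetric matrices of weighted bipartite graphs *)

Section HypergraphMatrix.
Variables (R : realType) (Th I1 I2 : finType) (row : Th -> I1) (col : Th -> I2).

Definition incident (x : I1 + I2) (t : Th) : bool :=
  match x with inl u => row t == u | inr v => col t == v end.

Definition cross (x y : I1 + I2) (t : Th) : bool :=
  match x, y with
  | inl u, inr v => (row t == u) && (col t == v)
  | inr v, inl u => (row t == u) && (col t == v)
  | _, _ => false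
  end.

Lemma cross_sym x y t : cross x y t = cross y x t.
Proof. by case: x y => [u|v] [u'|v']. Qed.

Lemma sum_cross x t : \sum_y (cross x y t)%:R = (incident x t)%:R :> R.
Proof.
case: x => [u|v]; rewrite big_sumType /=.
  rewrite big1 ?add0r // (bigD1 (col t)) //= eqxx andbT big1 ?addr0 // => i ni.
  by rewrite [_ == i]eq_sym (negPf ni) andbF.
rewrite [X in _ + X]big1 ?addr0 // (bigD1 (row t)) //= eqxx /= big1 ?addr0 // => i ni.
by rewrite [_ == i]eq_sym (negPf ni).
Qed.

(* The bipartite adjacency matrix of a weighted family of edges from [I1] to
   [I2], in symmetric form. *)
Definition edge_mx (w : Th -> R) : 'M[R]_#|{: I1 + I2}| :=
  \matrix_(i, j) \sum_t w t * (cross (enum_val i) (enum_val j) t)%:R.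

Lemma edge_mx_sym w : symmetric_mx (edge_mx w).
Proof.
by apply/matrixP => i j; rewrite !mxE; apply: eq_bigr => t _; rewrite cross_sym.
Qed.

Lemma edge_mx_rows w i :
  \sum_j `|edge_mx w i j| <= \sum_(t | incident (enum_val i) t) `|w t|.
Proof.
apply: (@le_trans _ _ (\sum_j \sum_t `|w t| * (cross (enum_val i) (enum_val j) t)%:R)).
  apply: ler_sum => j _; rewrite mxE; apply: le_trans (ler_norm_sum _ _ _) _.
  by apply: ler_sum => t _; rewrite normrM normr_nat.
rewrite exchange_big /= [leRHS]big_mkcond /=; apply: ler_sum => t _.
rewrite -mulr_sumr.
have -> : \sum_(j < #|{: I1 + I2}|) (cross (enum_val i) (enum_val j) t)%:R
        = (incident (enum_val i) t)%:R :> R.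
  by rewrite -sum_cross [RHS](reindex _ (onW_bij _ (@enum_val_bij _))).
by case: ifP; rewrite ?mulr1 ?mulr0.
Qed.

(** The half difference at [a] keeps exactly the edges whose support contains [a]. Each edge
    survives for [D] flips, which gives the homogeneity relation; edges with another support size
    must carry weight 0. *)
Lemma edge_tail (Omega A : finType) (W : Omega -> R) (phi : A -> Omega -> Omega)
    (supp : Th -> {set A}) (D : nat) (w : Omega -> Th -> R) (r1 r2 lambda : R) q :
  (forall o, 0 <= W o) -> (forall a, involutive (phi a)) ->
  (forall a o, W (phi a o) = W o) ->
  (0 < D)%N -> (forall t, #|supp t| = D \/ forall o, w o t = 0) ->
  (forall a o t, w (phi a o) t = (-1) ^+ (a \in supp t) * w o t) ->
  (forall o x, W o != 0 -> \sum_(t | incident x t) `|w o t| <= r1) ->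
  (forall o a x, W o != 0 ->
     \sum_(t | incident x t && (a \in supp t)) `|w o t| <= r2) ->
  0 <= r1 -> 0 <= r2 -> 0 < lambda ->
  \sum_(o | lambda ^+ q.*2 < \tr (edge_mx (w o) ^+ q.*2)) W o <=
    (4 * q%:R * (r1 * r2) / lambda ^+ 2) ^+ q * (#|{: I1 + I2}|%:R * \sum_o W o).
Proof.
move=> W0 phiK Wphi D0 suppD wphi wr1 wr2 r10 r20 l0.
have HE a o : 2^-1 *: (edge_mx (w o) - edge_mx (w (phi a o)))
            = edge_mx (fun t => (a \in supp t)%:R * w o t).
  apply/matrixP => i j; rewrite !mxE -sumrB mulr_sumr; apply: eq_bigr => t _.
  by rewrite wphi; case: (a \in supp t) => /=; rewrite ?expr1 ?expr0; field.
apply: (trace_tail W0 phiK Wphi (D := D%:R)) => //.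
- by move=> o; exact: edge_mx_sym.
- by rewrite ltr0n.
- move=> o; apply/matrixP => i j; rewrite summxE !mxE.
  under eq_bigr => a _ do rewrite HE mxE.
  rewrite exchange_big mulr_sumr; apply: eq_bigr => t _ /=.
  rewrite -mulr_suml -mulr_suml -mulrA.
  have [sD|w0] := suppD t; last by rewrite w0 !mul0r !mulr0.
  congr (_ * _).
  by rewrite -natr_sum -sD -sum1_card [in RHS]big_mkcond /=;
    congr _%:R; apply: eq_bigr => a _; case: (a \in _).
- move=> o a i o0; rewrite HE; apply: le_trans (edge_mx_rows _ _) _.
  apply: le_trans (wr2 o a (enum_val i) o0).
  rewrite big_mkcond [leRHS]big_mkcond /=; apply: ler_sum => t _.
  by case: (incident _ _) => //=; case: (a \in _); rewrite ?mul1r ?mul0r ?normr0.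
- move=> o i o0; under eq_bigr => a _ do rewrite HE.
  apply: le_trans (ler_sum _ (fun a _ => edge_mx_rows _ i)) _.
  rewrite exchange_big /=.
  apply: (@le_trans _ _ (\sum_(t | incident (enum_val i) t) D%:R * `|w o t|)).
    apply: ler_sum => t _; under eq_bigr => a _ do rewrite normrM normr_nat.
    rewrite -mulr_suml -natr_sum.
    have [sD|->] := suppD t; last by rewrite normr0 !mulr0.
    apply: ler_wpM2r => //.
    rewrite ler_nat -sD -sum1_card [in leqRHS]big_mkcond /=.
    by apply: leq_sum => a _; case: (a \in _).
  by rewrite -mulr_sumr; apply: ler_wpM2l => //; exact: wr1.
Qed.

End HypergraphMatrix.

(** * From traces to sums of squares *)

Section TraceCertificate.
Variables (R : realType) (n N d e : nat) (z : 'I_N -> {mpoly R[n]}).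
Hypotheses (z_deg : forall i, deg_le (z i) e) (e_le : (e.*2 <= d)%N).
Implicit Types (A B : 'M[R]_N) (lambda : R).

Definition mx_app A i := \sum_j A i j *: z j.
Definition sqnorm := \sum_i z i ^+ 2.
Definition quad A := \sum_i z i * mx_app A i.

Lemma mx_app_deg A i : deg_le (mx_app A i) e.
Proof. by apply: deg_le_sum => j _; exact: deg_leZ. Qed.

Lemma quad_sqr A : symmetric_mx A -> quad (A *m A) = \sum_i mx_app A i ^+ 2.
Proof.
move=> sA.
transitivity (\sum_i \sum_j A i j *: (z i * mx_app A j)).
  apply: eq_bigr => i _; rewrite /mx_app mulr_sumr.
  under [RHS]eq_bigr => j _ do rewrite mulr_sumr scaler_sumr.
  rewrite exchange_big /=; apply: eq_bigr => l _.
  rewrite mxE scaler_suml mulr_sumr; apply: eq_bigr => j _.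
  by rewrite -!scalerAr scalerA.
rewrite exchange_big; apply: eq_bigr => j _ /=.
rewrite expr2 {2}/mx_app mulr_suml; apply: eq_bigr => i _.
by rewrite -scalerAl -{1}sA mxE.
Qed.

Lemma sqnorm_cone : box_cone d sqnorm.
Proof. by apply: box_cone_sum => i _; exact: box_cone_sqr e_le (z_deg i). Qed.

(** Lagrange's identity, row by row: the defect in Cauchy-Schwarz is half the sum of the squared 2
    by 2 minors. *)
Lemma frobenius_cone A : symmetric_mx A ->
  box_cone d (\tr (A *m A) *: sqnorm - quad (A *m A)).
Proof.
move=> sA; rewrite quad_sqr // -{2}sA trace_gram scaler_suml -sumrB.
apply: box_cone_sum => i _.
suff -> : (\sum_j A i j ^+ 2) *: sqnorm - mx_app A i ^+ 2
    = 2^-1 *: \sum_j \sum_l (A i j *: z l - A i l *: z j) ^+ 2.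
  apply: box_coneZ; first by rewrite invr_ge0.
  do 2![apply: box_cone_sum => ? _]; apply: box_cone_sqr e_le _.
  by apply: deg_leD; [|apply: deg_leN]; apply: deg_leZ.
have sqE j l : (A i j *: z l - A i l *: z j) ^+ 2
   = (A i j ^+ 2 *: z l ^+ 2 + A i l ^+ 2 *: z j ^+ 2)
     - 2 *: ((A i j *: z j) * (A i l *: z l)).
  by rewrite -!mul_mpolyC !rmorphXn /= mpolyC_nat; ring.
under [in RHS]eq_bigr => j _ do under eq_bigr => l _ do rewrite sqE.
under [in RHS]eq_bigr => j _ do rewrite sumrB big_split /=.
rewrite sumrB big_split /=.
have S1 : \sum_j \sum_l A i j ^+ 2 *: z l ^+ 2 = (\sum_j A i j ^+ 2) *: sqnorm.
  by rewrite scaler_suml; apply: eq_bigr => j _; rewrite scaler_sumr.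
have S2 : \sum_j \sum_l A i l ^+ 2 *: z j ^+ 2 = (\sum_j A i j ^+ 2) *: sqnorm.
  by rewrite exchange_big.
rewrite S1 S2.
have -> : \sum_j \sum_l 2 *: ((A i j *: z j) * (A i l *: z l)) = 2 *: mx_app A i ^+ 2.
  rewrite expr2 /mx_app big_distrlr /= scaler_sumr; apply: eq_bigr => j _.
  by rewrite scaler_sumr.
have h2 : 2^-1 + 2^-1 = 1 :> R by field.
by rewrite scalerBr scalerDr -[in RHS]scalerDl h2 scale1r scalerA mulVf ?scale1r ?pnatr_eq0.
Qed.

Lemma quad_cone_sqrt A lambda : symmetric_mx A -> 0 < lambda ->
  box_cone d (lambda ^+ 2 *: sqnorm - quad (A *m A)) ->
  box_cone d (lambda *: sqnorm - quad A).
Proof.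
move=> sA l0 cA.
have -> : lambda *: sqnorm - quad A = (2 * lambda)^-1 *:
    (\sum_i (lambda *: z i - mx_app A i) ^+ 2 +
     (lambda ^+ 2 *: sqnorm - quad (A *m A))).
  have -> : \sum_i (lambda *: z i - mx_app A i) ^+ 2
          = lambda ^+ 2 *: sqnorm - (2 * lambda) *: quad A + quad (A *m A).
    rewrite quad_sqr // /sqnorm /quad !scaler_sumr -sumrB -big_split /=.
    apply: eq_bigr => i _.
    by rewrite -!mul_mpolyC !rmorphXn !rmorphM /= mpolyC_nat; ring.
  have abc (a b c : {mpoly R[n]}) : a - b + c + (a - c) = a + a - b by ring.
  rewrite abc -[in RHS]scalerDl.
  have -> : lambda ^+ 2 + lambda ^+ 2 = (2 * lambda) * lambda by ring.
  by rewrite -(scalerA (2 * lambda)) -scalerBr scalerA mulVf ?scale1r // gt_eqF // mulr_gt0.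
apply: box_coneZ; first by rewrite invr_ge0 mulr_ge0 // ltW.
apply: box_coneD cA; apply: box_cone_sum => i _; apply: box_cone_sqr e_le _.
by apply: deg_leD; [exact: deg_leZ|apply: deg_leN; exact: mx_app_deg].
Qed.

(** Passing from [A] to its square halves the exponent of the trace. The descent ends at exponent 2,
    where the trace is the squared Frobenius norm. *)
Lemma trace_cone r A lambda : symmetric_mx A -> 0 < lambda ->
  \tr (A ^+ (2 ^ r).*2) <= lambda ^+ (2 ^ r).*2 ->
  box_cone d (lambda *: sqnorm - quad A).
Proof.
elim: r A lambda => [|r IHr] A lambda sA l0 trA; apply: quad_cone_sqrt => //.
  have -> : lambda ^+ 2 *: sqnorm - quad (A *m A)
    = (lambda ^+ 2 - \tr (A *m A)) *: sqnorm + (\tr (A *m A) *: sqnorm - quad (A *m A)).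
    by rewrite scalerBl addrA subrK.
  apply: box_coneD (frobenius_cone sA); apply: box_coneZ sqnorm_cone.
  by rewrite subr_ge0.
have AA : A *m A = A ^+ 2 by rewrite expr2.
apply: IHr; first by rewrite AA; exact: symmetric_exp.
  by rewrite exprn_gt0.
by rewrite AA -!exprM; move: trA; rewrite expnS -!mul2n.
Qed.

End TraceCertificate.

(** * Certificates for bilinear forms *)

Section EdgeCertificate.
Variables (R : realType) (n d e : nat) (Th I1 I2 : finType).
Variables (row : Th -> I1) (col : Th -> I2).
Variables (y1 : I1 -> {mpoly R[n]}) (y2 : I2 -> {mpoly R[n]}).
Hypotheses (y1_deg : forall i, deg_le (y1 i) e) (y2_deg : forall i, deg_le (y2 i) e).
Hypothesis e_le : (e.*2 <= d)%N.

(** Even powers do not see the sign, so one trace bound certifies the form from above and from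
    below. *)
Lemma trace_edge_mxN (w : Th -> R) m :
  \tr (edge_mx row col (fun t => - w t) ^+ m.*2) = \tr (edge_mx row col w ^+ m.*2).
Proof.
have -> : edge_mx row col (fun t => - w t) = - edge_mx row col w.
  apply/matrixP => i j; rewrite !mxE -sumrN.
  by apply: eq_bigr => t _; rewrite mulNr.
by rewrite -mul2n !exprM sqrrN.
Qed.

(** The quadratic form of the symmetric matrix counts each edge twice, whence [lambda / 2]. *)
Lemma edge_cone r (w : Th -> R) lambda : 0 < lambda ->
  \tr (edge_mx row col w ^+ (2 ^ r).*2) <= lambda ^+ (2 ^ r).*2 ->
  box_cone d ((lambda / 2) *: (\sum_u y1 u ^+ 2 + \sum_v y2 v ^+ 2)
              - \sum_t w t *: (y1 (row t) * y2 (col t))).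
Proof.
move=> l0 trw.
pose y (x : I1 + I2) := match x with inl u => y1 u | inr v => y2 v end.
pose z (i : 'I_#|{: I1 + I2}|) := y (enum_val i).
have zd i : deg_le (z i) e by rewrite /z /y; case: (enum_val i).
have reE (F : I1 + I2 -> {mpoly R[n]}) :
    \sum_(i < #|{: I1 + I2}|) F (enum_val i) = \sum_u F (inl u) + \sum_v F (inr v).
  transitivity (\sum_x F x); last by rewrite big_sumType.
  by rewrite [RHS](reindex _ (onW_bij _ (@enum_val_bij _))).
have := trace_cone zd e_le (edge_mx_sym row col w) l0 trw.
rewrite /sqnorm (reE (fun x => y x ^+ 2)) /=.
have -> : quad z (edge_mx row col w) = 2 *: \sum_t w t *: (y1 (row t) * y2 (col t)).
  transitivity (\sum_i \sum_j \sum_t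
     (w t * (cross row col (enum_val i) (enum_val j) t)%:R) *: (z i * z j)).
    apply: eq_bigr => i _; rewrite mulr_sumr; apply: eq_bigr => j _.
    by rewrite mxE -scalerAr scaler_suml.
  under eq_bigr => i _ do rewrite exchange_big /=.
  rewrite exchange_big /= scaler_sumr; apply: eq_bigr => t _.
  pose G x x' := (w t * (cross row col x x' t)%:R) *: (y x * y x').
  under eq_bigr => i _ do rewrite (reE (G (enum_val i))).
  rewrite (reE (fun x => \sum_u G x (inl u) + \sum_v G x (inr v))) /=.
  have G0 u : \sum_u' G (inl u) (inl u') = 0.
    by apply: big1 => u' _; rewrite /G mulr0 scale0r.
  have G0' v : \sum_v' G (inr v) (inr v') = 0.
    by apply: big1 => u' _; rewrite /G mulr0 scale0r.
  have S12 : \sum_u (\sum_u' G (inl u) (inl u') + \sum_v G (inl u) (inr v))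
           = w t *: (y1 (row t) * y2 (col t)).
    rewrite (bigD1 (row t)) //= G0 add0r [X in _ + X]big1 ?addr0; last first.
      move=> u nu; rewrite G0 add0r big1 // => v _.
      by rewrite /G /= eq_sym (negPf nu) mulr0 scale0r.
    rewrite (bigD1 (col t)) //= big1 ?addr0.
      by rewrite /G /= !eqxx mulr1.
    by move=> v nv; rewrite /G /= [_ == v]eq_sym (negPf nv) andbF mulr0 scale0r.
  have S21 : \sum_v (\sum_u G (inr v) (inl u) + \sum_v' G (inr v) (inr v'))
           = w t *: (y1 (row t) * y2 (col t)).
    rewrite (bigD1 (col t)) //= G0' addr0 [X in _ + X]big1 ?addr0; last first.
      move=> v nv; rewrite G0' addr0 big1 // => u _.
      by rewrite /G /= [_ == v]eq_sym (negPf nv) andbF mulr0 scale0r.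
    rewrite (bigD1 (row t)) //= big1 ?addr0.
      by rewrite /G /= !eqxx mulr1 mulrC.
    by move=> u nu; rewrite /G /= [_ == u]eq_sym (negPf nu) mulr0 scale0r.
  by rewrite S12 S21 -mulr2n scaler_nat.
move=> /(box_coneZ (_ : 0 <= 2^-1)); rewrite invr_ge0 => /(_ (ler0n _ 2)).
by rewrite scalerBr !scalerA mulVf ?pnatr_eq0 // scale1r mulrC.
Qed.

End EdgeCertificate.

(** * Random subsets *)

Section RandomSubset.
Variables (R : realType) (T : finType) (p : R).
Hypothesis p01 : 0 <= p <= 1.
Implicit Types (J : {set T}) (C : T).

Definition subset_weight J : R := \prod_(C : T) (if C \in J then p else 1 - p).

Let p_ge0 : 0 <= p. Proof. by case/andP: p01. Qed.
Let q_ge0 : 0 <= 1 - p. Proof. by rewrite subr_ge0; case/andP: p01. Qed.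

Lemma subset_weight_ge0 J : 0 <= subset_weight J.
Proof. by apply: prodr_ge0 => C _; case: ifP. Qed.

Lemma sum_subset_weight : \sum_J subset_weight J = 1.
Proof.
transitivity (\prod_(C : T) (p + (1 - p))); first by rewrite bigA_distr.
by rewrite big1 // => C _; rewrite addrC subrK.
Qed.

Lemma subset_weight_imset (f : T -> T) J : involutive f ->
  subset_weight (f @: J) = subset_weight J.
Proof.
move=> fK; rewrite /subset_weight (reindex_inj (inv_inj fK)) /=.
by apply: eq_bigr => C _; rewrite mem_imset //; exact: inv_inj.
Qed.

(** Membership of [C] is independent of the rest of [J], so it may be redrawn: the right-hand side
    averages the conditional expectation given [J] without [C]. *)
Lemma resample C (g : {set T} -> R) :
  \sum_J subset_weight J * g J =
  \sum_J subset_weight J * (p * g (C |: J) + (1 - p) * g (J :\ C)).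
Proof.
pose W J : R := \prod_(C' | C' != C) (if C' \in J then p else 1 - p).
have weE J : subset_weight J = (if C \in J then p else 1 - p) * W J.
  by rewrite /subset_weight (bigD1 C).
have WU J : W (C |: J) = W J.
  by apply: eq_bigr => C' nC; rewrite !inE (negPf nC).
have split (h : {set T} -> R) :
    \sum_J h J = \sum_(J : {set T} | C \notin J) (h (C |: J) + h J).
  rewrite (bigID (fun J : {set T} => C \in J)) /= big_split /=; congr (_ + _).
  rewrite (reindex_onto (fun J : {set T} => C |: J) (fun J : {set T} => J :\ C)) /=; last first.
    by move=> J CJ; rewrite finset.setD1K.
  apply: eq_bigl => J; rewrite finset.setU11 /=; apply/eqP/idP => [<-|CJ].
    by rewrite finset.setD11.
  exact: finset.setU1K.
rewrite !split; apply: eq_bigr => J CJ.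
have UU : C |: (C |: J) = C |: J by rewrite finset.setUA finset.setUid.
have DJ : J :\ C = J.
  by apply/setP => x; rewrite !inE; case: eqP => // ->; rewrite (negPf CJ).
rewrite !weE WU finset.setU11 (negPf CJ) UU (finset.setU1K CJ) DJ.
by ring.
Qed.

(* [a C J] depends only on the part of [J] enumerated before [C], so the factors
   can be averaged out one at a time, the last one first. *)
Lemma predictable_mgf (a : T -> {set T} -> R) :
  (forall C C' J, (enum_rank C <= enum_rank C')%N -> a C (C' |: J) = a C (J :\ C')) ->
  \sum_J subset_weight J *
    expR (\sum_C ((C \in J)%:R * a C J - p * (expR (a C J) - 1))) <= 1.
Proof.
move=> pred_a.
pose t C J := (C \in J)%:R * a C J - p * (expR (a C J) - 1).
pose S m J := \sum_(C | (enum_rank C < m)%N) t C J.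
suff le1 m : (m <= #|T|)%N -> \sum_J subset_weight J * expR (S m J) <= 1.
  apply: le_trans (le1 #|T| (leqnn _)).
  by apply: ler_sum => J _; rewrite /S [in leRHS](eq_bigl xpredT) // => C; rewrite ltn_ord.
elim: m => [|m IHm] mT.
  rewrite -[leRHS]sum_subset_weight; apply: ler_sum => J _.
  by rewrite /S big_pred0 // expR0 mulr1.
apply: le_trans (IHm (ltnW mT)).
pose C := enum_val (Ordinal mT).
have rkC : enum_rank C = m :> nat by rewrite /C enum_valK.
have SE J : S m.+1 J = t C J + S m J.
  rewrite /S (bigD1 C) ?rkC //=; congr (_ + _); apply: eq_bigl => C'.
  rewrite ltnS leq_eqVlt -rkC.
  have -> : (enum_rank C' == enum_rank C :> nat) = (C' == C).
    by apply/eqP/eqP => [/val_inj/enum_rank_inj|->].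
  by case: eqP => [->|]; rewrite ?ltnn ?andbF ?andbT.
have Sinv J : S m (C |: J) = S m (J :\ C).
  apply: eq_bigr => C' ltC'; rewrite /t pred_a; last by rewrite rkC ltnW.
  have nC : C' != C by apply: contraTneq ltC' => ->; rewrite rkC ltnn.
  by rewrite !inE (negPf nC).
(* Predictability with [C' = C]: the coefficient of [C] ignores whether [C] itself is present. *)
have aU J J' : J :\ C = J' :\ C -> a C J = a C J'.
  have aD K : a C K = a C (K :\ C).
    rewrite -[in RHS](pred_a C C K) //; have [CK|CK] := boolP (C \in K).
      by rewrite (finset.setUidPr _) // finset.sub1set.
    rewrite (pred_a C C K) //; congr (a C _); apply/setP => x; rewrite !inE.
    by case: eqP => // ->; rewrite (negPf CK).
  by move=> JJ; rewrite (aD J) JJ -aD.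
have SU J J' : J :\ C = J' :\ C -> S m J = S m J'.
  move=> JJ; apply: eq_bigr => C' ltC'.
  have nC : C' != C by apply: contraTneq ltC' => ->; rewrite rkC ltnn.
  have aD K : a C' K = a C' (K :\ C).
    have le : (enum_rank C' <= enum_rank C)%N by rewrite rkC ltnW.
    rewrite -[in RHS](pred_a C' C K le); have [CK|CK] := boolP (C \in K).
      by rewrite (finset.setUidPr _) // finset.sub1set.
    rewrite (pred_a C' C K le); congr (a C' _); apply/setP => x; rewrite !inE.
    by case: eqP => // ->; rewrite (negPf CK).
  have memE : (C' \in J) = (C' \in J').
    by move/setP/(_ C'): JJ; rewrite !inE nC.
  by rewrite /t (aD J) JJ -aD memE.
rewrite (resample C); apply: ler_sum => J _.
apply: ler_wpM2l; first exact: subset_weight_ge0.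
have U1 : (C |: J) :\ C = J :\ C by rewrite finset.setDUl finset.setDv finset.set0U.
have D1 : (J :\ C) :\ C = J :\ C by rewrite finset.setDDl finset.setUid.
rewrite !SE /t (aU _ _ U1) (aU _ _ D1) (SU _ _ U1) (SU _ _ D1) !inE eqxx /= mul1r mul0r sub0r.
set b := a C J; set s := S m J.
set E := p * (expR b - 1).
(* The compensator [E] is chosen so that averaging over the membership of [C] leaves the factor
   [(1 + E) e^-E], which is at most 1. *)
have -> : p * expR (b - E + s) + (1 - p) * expR (- E + s)
        = (1 + E) * expR (- E) * expR s by rewrite /E !expRD; ring.
rewrite -[leRHS]mul1r ler_pM2r ?expR_gt0 // expRN ler_pdivrMr ?expR_gt0 // mul1r.
exact: expR_ge1Dx.
Qed.

(** From [e^(x/2) <= 1 / (1 - x/2)], squared. The constant is the value of [(1 - x/2)^-2 - 1] at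
    [x = 1]. *)
Lemma expR_sub1_le (x : R) : 0 <= x <= 1 -> expR x - 1 <= 3 * x.
Proof.
move=> /andP[x0 x1].
have h : expR (x / 2) * (1 - x / 2) <= 1.
  have := expR_ge1Dx (- (x / 2)); rewrite expRN => h.
  by rewrite -[leRHS](@mulfV _ (expR (x / 2))) ?gt_eqF ?expR_gt0 // ler_pM2l ?expR_gt0.
have xE : expR x = expR (x / 2) ^+ 2.
  by rewrite expr2 -expRD; congr expR; field.
have e0 := expR_gt0 (x / 2); rewrite xE; set y := expR (x / 2) in h e0 *.
have y2 : y ^+ 2 * (1 - x / 2) ^+ 2 <= 1.
  by rewrite -exprMn expr_le1 // mulr_ge0 ?(ltW e0) //; lra.
have d0 : 0 < (1 - x / 2) ^+ 2 by rewrite exprn_gt0 //; lra.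
rewrite lerBlDr -(ler_pM2r d0); apply: le_trans y2 _.
have : 0 <= x * (1 - x) * (8 - 3 * x) by rewrite !mulr_ge0 //; lra.
rewrite !expr2; lra.
Qed.

Lemma markov_weight (f : {set T} -> R) (s : R) :
  \sum_J subset_weight J * expR (f J) <= 1 ->
  \sum_(J | s < f J) subset_weight J <= expR (- s).
Proof.
move=> mgf; rewrite expRN -[leRHS]mul1r ler_pdivlMr ?expR_gt0 //.
apply: le_trans mgf; rewrite mulr_suml big_mkcond /=; apply: ler_sum => J _.
case: ifP => [sf|_]; last by rewrite mulr_ge0 ?subset_weight_ge0 ?expR_ge0.
by apply: ler_wpM2l; [exact: subset_weight_ge0|rewrite ler_expR ltW].
Qed.

(** Markov's inequality for the exponential moment. The comparison sum over all [C] is itself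
    random; bounding it is left to each application. *)
Lemma predictable_tail (a : T -> {set T} -> R) (s : R) :
  (forall C C' J, (enum_rank C <= enum_rank C')%N -> a C (C' |: J) = a C (J :\ C')) ->
  (forall C J, 0 <= a C J <= 1) ->
  \sum_(J : {set T} | 3 * p * (\sum_C a C J) + s < \sum_(C in J) a C J) subset_weight J
    <= expR (- s).
Proof.
move=> pred_a a01.
apply: le_trans (markov_weight s (predictable_mgf pred_a)).
rewrite big_mkcond [leRHS]big_mkcond /=; apply: ler_sum => J _.
case: ifP => [h|_]; last by case: ifP => // _; exact: subset_weight_ge0.
suff -> : s < \sum_C ((C \in J)%:R * a C J - p * (expR (a C J) - 1)) by [].
rewrite sumrB -mulr_sumr.
have -> : \sum_C (C \in J)%:R * a C J = \sum_(C in J) a C J.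
  rewrite [RHS]big_mkcond; apply: eq_bigr => C _.
  by case: (C \in J); rewrite ?mul1r ?mul0r.
rewrite ltrBrDl; apply: le_lt_trans h; rewrite lerD2r.
rewrite [3 * p]mulrC -mulrA; apply: ler_wpM2l => //.
by rewrite mulr_sumr; apply: ler_sum => C _; exact: expR_sub1_le.
Qed.

(** The exponential bound is applied with the constant coefficient [-1]. As [e^-1 <= 1/2], the
    compensator yields at least half the mean size; half of this pays for the threshold and half
    stays in the exponent. *)
Lemma size_lower_tail :
  \sum_(J : {set T} | #|J|%:R < p * #|T|%:R / 4) subset_weight J <= expR (- (p * #|T|%:R / 4)).
Proof.
have mgf := predictable_mgf (a := fun _ _ => -1) (fun _ _ _ _ => erefl).
apply: le_trans (markov_weight (p * #|T|%:R / 4) mgf).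
rewrite big_mkcond [leRHS]big_mkcond /=; apply: ler_sum => J _.
case: ifP => [h|_]; last by case: ifP => // _; exact: subset_weight_ge0.
suff -> : p * #|T|%:R / 4 < \sum_C ((C \in J)%:R * (-1) - p * (expR (-1) - 1)) by [].
rewrite sumrB -mulr_suml sumr_const.
have -> : \sum_C (C \in J)%:R = #|J|%:R :> R.
  by rewrite -natr_sum -sum1_card [in RHS]big_mkcond /=; congr _%:R;
    apply: eq_bigr => C _; case: (C \in J).
have e1 : expR (-1) <= 2^-1 :> R.
  rewrite expRN lef_pV2 ?posrE ?expR_gt0 //.
  by apply: le_trans (expR_ge1Dx 1); lra.
rewrite -[_ *+ _]mulr_natr.
have N0 : 0 <= p * #|T|%:R by rewrite mulr_ge0.
have : p * #|T|%:R * (expR (-1) - 1) <= p * #|T|%:R * (- 2^-1).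
  by apply: ler_wpM2l => //; lra.
lra.
Qed.

End RandomSubset.

(** * Counting keyed pairs *)

Section FiberCounts.
Variables (R : realType) (T : finType) (p : R).
Hypothesis p01 : 0 <= p <= 1.
Implicit Types (J : {set T}) (C : T).

Definition Pr (E : pred {set T}) : R := \sum_(J | E J) subset_weight p J.

Lemma Pr_mono (E E' : pred {set T}) : (forall J, E J -> E' J) -> Pr E <= Pr E'.
Proof.
move=> sub; rewrite /Pr big_mkcond [leRHS]big_mkcond /=; apply: ler_sum => J _.
case: ifP => [/sub -> //|_]; case: ifP => // _; exact: subset_weight_ge0.
Qed.

Lemma Pr_union (E E1 E2 : pred {set T}) :
  (forall J, E J -> E1 J || E2 J) -> Pr E <= Pr E1 + Pr E2.
Proof.
move=> sub; rewrite /Pr big_mkcond [X in _ <= X + _]big_mkcond.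
rewrite [X in _ <= _ + X]big_mkcond -big_split /=; apply: ler_sum => J _.
have w0 := subset_weight_ge0 p01 J; have := sub J.
case: (E J) => [/(_ isT)|_].
  by case: (E1 J); case: (E2 J) => //= _; rewrite ?addr0 ?add0r ?lerDl.
by apply: addr_ge0; case: ifP.
Qed.

Lemma Pr_exists (I : finType) (E : pred {set T}) (F : I -> pred {set T}) (eps : R) :
  (forall J, E J -> [exists i, F i J]) -> (forall i, Pr (F i) <= eps) ->
  Pr E <= #|I|%:R * eps.
Proof.
move=> sub Feps; apply: (@le_trans _ _ (\sum_i Pr (F i))); last first.
  by rewrite mulr_natl -sumr_const; apply: ler_sum.
rewrite /Pr big_mkcond; under [leRHS]eq_bigr => i _ do rewrite big_mkcond.
rewrite exchange_big /=; apply: ler_sum => J _.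
have w0 := subset_weight_ge0 p01 J.
case: ifP => [/sub/existsP[i Fi]|_]; last first.
  by apply: sumr_ge0 => i _; case: ifP.
by rewrite (bigD1 i) //= Fi lerDl; apply: sumr_ge0 => j _; case: ifP.
Qed.

Lemma Pr_ge0 (E : pred {set T}) : 0 <= Pr E.
Proof. by apply: sumr_ge0 => J _; exact: subset_weight_ge0. Qed.

Lemma Pr_compl (E : pred {set T}) : Pr E = 1 - Pr (predC E).
Proof.
rewrite -(sum_subset_weight T p) (bigID E) /= addrK.
by [].
Qed.

Definition count (P : pred T) J : nat := #|[set C in J | P C]|.

Lemma count_nat (P : pred T) J : count P J = (\sum_(C in J) P C)%N.
Proof.
rewrite /count -sum1_card big_mkcond [RHS]big_mkcond /=.
by apply: eq_bigr => C _; rewrite inE; case: (C \in J); case: (P C).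
Qed.

Lemma count_sum (P : pred T) J : (count P J)%:R = \sum_(C in J) (P C)%:R :> R.
Proof. by rewrite count_nat natr_sum. Qed.

Lemma count_tail (P : pred T) (s : R) :
  Pr (fun J => 3 * p * #|P|%:R + s < (count P J)%:R) <= expR (- s).
Proof.
have := predictable_tail p01 (a := fun C _ => (P C)%:R) s.
move=> /(_ (fun _ _ _ _ => erefl)) h.
apply: le_trans (h _); last by move=> C _; case: (P C); rewrite !lexx ?ler01.
apply: Pr_mono => J; rewrite count_sum.
suff -> : \sum_C (P C)%:R = #|P|%:R :> R by [].
rewrite -sum1_card natr_sum [RHS]big_mkcond /=; apply: eq_bigr => C _.
by rewrite unfold_in; case: (P C).
Qed.

Section KeyedPairs.
Variables (B K : finType) (base : T -> B) (key : T -> K) (f1 f0 : nat) (s : R).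
Hypothesis fiber1 : forall i u, (#|[pred C | (base C == i) && (key C == u)]| <= f1)%N.
Hypothesis fiber0 : forall u, (#|[pred C | key C == u]| <= f0)%N.
Hypothesis s_gt0 : 0 < s.

Let p_ge0 : 0 <= p. Proof. by case/andP: p01. Qed.

(** High-probability bounds: [D2] for the members with given base and key, [Z] for those with given
    key, [r1] for pairs. The factor 2 in [r1] accounts for the two orders of a pair. *)
Let D2 : R := 3 * p * f1%:R + s.
Let Z : R := 3 * p * f0%:R + s.
Let r1 : R := 2 * (3 * p * f1%:R * Z + D2 * s).

Let D2_gt0 : 0 < D2.
Proof. by rewrite /D2 ltr_wpDl // !mulr_ge0. Qed.

Definition light1 J :=
  [forall i, forall u, (count [pred C | (base C == i) && (key C == u)] J)%:R <= D2].
Definition light0 J := [forall u, (count [pred C | key C == u] J)%:R <= Z].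

Definition pairs u u' J : nat :=
  \sum_(C in J | key C == u)
    count [pred C' | [&& base C' == base C, key C' == u' & C' != C]] J.

Definition earlier u u' J : nat :=
  \sum_(C in J | key C == u)
    count [pred C' | [&& base C' == base C, key C' == u' &
                        (enum_rank C' < enum_rank C)%N]] J.

(** One of two distinct members comes later in the enumeration. Splitting by which one it is makes
    the count predictable, which the symmetric count is not. *)
Lemma pairs_earlier u u' J : (pairs u u' J <= earlier u u' J + earlier u' u J)%N.
Proof.
rewrite /pairs /earlier.
under eq_bigr => C _ do rewrite count_nat.
under [X in (_ <= X + _)%N]eq_bigr => C _ do rewrite count_nat.
under [X in (_ <= _ + X)%N]eq_bigr => C _ do rewrite count_nat.
rewrite !big_mkcondr /=.
have toS (P : T -> T -> bool) (v : K) : (\sum_(C in J) (if key C == v then \sum_(C' in J) P C C' else 0)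
    = \sum_(C in J) \sum_(C' in J) ((key C == v) && P C C'))%N.
  by apply: eq_bigr => C _; case: (key C == v) => //=; rewrite big1.
rewrite !toS [X in (_ <= _ + X)%N]exchange_big -big_split /=.
apply: leq_sum => C _; rewrite -big_split /=; apply: leq_sum => C' _.
rewrite [base C' == _]eq_sym; case: (base C == _) => //=; last by rewrite !andbF.
case: (key C == u) => //=; case: (key C' == u') => //=.
have [->|nC] := eqVneq C' C; first by [].
by case: ltngtP => // /val_inj /enum_rank_inj /eqP; rewrite (negPf nC).
Qed.

(* A member [C] of [J] with key [u] contributes the number of its partners that
   come earlier in the enumeration.  This number is predictable, and at most [D2]
   on [light1]. *)
Lemma earlier_tail u u' :
  Pr (fun J => [&& light1 J, light0 J &
                3 * p * f1%:R * Z + D2 * s < (earlier u u' J)%:R]) <= expR (- s).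
Proof.
pose b C J := count [pred C' | [&& base C' == base C, key C' == u' &
                        (enum_rank C' < enum_rank C)%N]] J.
(* Truncation keeps the coefficients in [[0, 1]] for every [J]; on [light1] it has no effect. *)
pose a C J : R := (key C == u)%:R * Num.min 1 ((b C J)%:R / D2).
have pred_a C C' J : (enum_rank C <= enum_rank C')%N -> a C (C' |: J) = a C (J :\ C').
  move=> le; rewrite /a; congr (_ * Num.min 1 (_%:R / _)); rewrite /b /count.
  apply: eq_card => x; rewrite !inE; have [->|] := eqVneq x C'; last by [].
  by rewrite ltnNge le !andbF.
have a01 C J : 0 <= a C J <= 1.
  rewrite /a; case: (key C == u); rewrite ?mul0r ?lexx ?ler01 // mul1r.
  by rewrite le_min ler01 ge_min lexx /= divr_ge0 // ltW.
apply: le_trans (predictable_tail p01 s pred_a a01).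
apply: Pr_mono => J /and3P[/forallP l1 /forallP l0 big].
have bD C : (b C J)%:R <= D2.
  have /forallP/(_ u') := l1 (base C); apply: le_trans; rewrite ler_nat.
  by apply: subset_leq_card; apply/fintype.subsetP => x; rewrite !inE => /and4P[-> -> ->].
have aE C : a C J = (key C == u)%:R * (b C J)%:R / D2.
  rewrite /a -mulrA; congr (_ * _); apply/min_idPr.
  by rewrite ler_pdivrMr // mul1r.
have SaJ : \sum_(C in J) a C J = (earlier u u' J)%:R / D2.
  rewrite /earlier natr_sum mulr_suml big_mkcondr /=; apply: eq_bigr => C _.
  by rewrite aE; case: (key C == u); rewrite ?mul1r ?mul0r.
rewrite SaJ ltr_pdivlMr //; apply: le_lt_trans big.
rewrite mulrDl [s * _]mulrC lerD2r -!mulrA.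
apply: ler_wpM2l => //; apply: ler_wpM2l => //.
have -> : (\sum_C a C J) * D2 = \sum_(C | key C == u) (b C J)%:R.
  rewrite mulr_suml [RHS]big_mkcond /=; apply: eq_bigr => C _.
  by rewrite aE mulfVK ?gt_eqF //; case: (key C == u); rewrite ?mul1r ?mul0r.
apply: (@le_trans _ _ (\sum_(C | key C == u) \sum_(C' in J)
                        ((base C' == base C) && (key C' == u'))%:R)).
  apply: ler_sum => C _; rewrite /b count_sum; apply: ler_sum => C' _ /=.
  by rewrite ler_nat; case: (_ == _) => //=; case: (_ == _) => //=; case: (_ < _)%N.
(* For a fixed partner [C'] the possible [C] lie in one fiber of base and key, so there are at most
   [f1] of them; [light0] then bounds the number of partners. *)
rewrite exchange_big /=.
apply: (@le_trans _ _ (\sum_(C' in J) (key C' == u')%:R * f1%:R)).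
  apply: ler_sum => C' _; case: (key C' == u'); last first.
    by rewrite big1 ?mul0r // => C _; rewrite andbF.
  rewrite mul1r -natr_sum ler_nat.
  apply: leq_trans (fiber1 (base C') u).
  rewrite -sum1_card big_mkcond [leqRHS]big_mkcond /=; apply: leq_sum => C _.
  by rewrite inE andbT [base C' == _]eq_sym; case: (key C == u); case: (_ == _).
rewrite -mulr_suml mulrC -count_sum; apply: ler_wpM2l => //.
exact: l0.
Qed.

Definition spread J :=
  light1 J && [forall u, forall u', (pairs u u' J)%:R <= r1].

Lemma spread_tail :
  Pr (fun J => ~~ spread J) <=
    (#|B| * #|K| + #|K| + #|K| * #|K|)%:R * expR (- s).
Proof.
pose E1 J := ~~ light1 J; pose E0 J := ~~ light0 J.
pose E2 J := [&& light1 J, light0 J & ~~ [forall u, forall u', (pairs u u' J)%:R <= r1]].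
have P1 : Pr E1 <= (#|B| * #|K|)%:R * expR (- s).
  rewrite -card_prod; pose Q (iu : B * K) := [pred C | (base C == iu.1) && (key C == iu.2)].
  apply: (Pr_exists (F := fun iu J => 3 * p * #|Q iu|%:R + s < (count (Q iu) J)%:R)).
    move=> J /forallPn[i /forallPn[u]]; rewrite -ltNge => lt.
    apply/existsP; exists (i, u); apply: le_lt_trans lt; rewrite lerD2r.
    by apply: ler_wpM2l; rewrite ?mulr_ge0 // ler_nat fiber1.
  by move=> iu; exact: count_tail.
have P0 : Pr E0 <= #|K|%:R * expR (- s).
  pose Q u := [pred C | key C == u].
  apply: (Pr_exists (F := fun u J => 3 * p * #|Q u|%:R + s < (count (Q u) J)%:R)).
    move=> J /forallPn[u]; rewrite -ltNge => lt.
    apply/existsP; exists u; apply: le_lt_trans lt; rewrite lerD2r.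
    by apply: ler_wpM2l; rewrite ?mulr_ge0 // ler_nat fiber0.
  by move=> u; exact: count_tail.
have P2 : Pr E2 <= (#|K| * #|K|)%:R * expR (- s).
  rewrite -card_prod; apply: (Pr_exists (F := fun uu J => [&& light1 J, light0 J &
                3 * p * f1%:R * Z + D2 * s < (earlier uu.1 uu.2 J)%:R])).
    move=> J /and3P[l1 l0 /forallPn[u /forallPn[u']]]; rewrite -ltNge => lt.
    have := pairs_earlier u u' J; rewrite -(ler_nat R) natrD => le.
    apply/existsP; have := lt_le_trans lt le; rewrite /r1 mulr_natl mulr2n => lt2.
    (* At least one of the two ordered counts exceeds half of [r1]. *)
    have [lt3|le3] := ltP (3 * p * f1%:R * Z + D2 * s) (earlier u u' J)%:R.
      by exists (u, u'); rewrite l1 l0.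
    exists (u', u); rewrite l1 l0 /=; move: lt2 le3; lra.
  by move=> uu; exact: earlier_tail.
have PU : Pr (fun J => ~~ spread J) <= Pr E1 + Pr (fun J => E0 J || E2 J).
  apply: Pr_union => J; rewrite /spread /E1 /E0 /E2.
  by case: (light1 J) => //=; case: (light0 J).
have PV : Pr (fun J => E0 J || E2 J) <= Pr E0 + Pr E2 by exact: Pr_union.
rewrite !natrD !mulrDl; lra.
Qed.

End KeyedPairs.
End FiberCounts.

(** * Signed scope weights *)

Section ScopeWeights.
Variables (R : realType) (k n : nat) (S : {set 'I_k}) (i0 : 'I_k).
Hypothesis i0S : i0 \in S.
Notation scope := {ffun 'I_k -> 'I_n}.
Implicit Types (J : {set constraint k n}) (C : constraint k n) (a t : scope).

Definition mult J t : nat := count [pred C : constraint k n | C.2 == t] J.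

Definition sign_sum J t : R := \sum_(C in J | C.2 == t) chi R S C.1.

(* Flipping the sign at position [i0] in every constraint with scope [a] preserves
   the law of the instance and negates [sign_sum] at [a] only. *)
Definition flip a C : constraint k n :=
  if C.2 == a then ([ffun i => (i == i0) (+) C.1 i], C.2) else C.

Lemma flip_scope a C : (flip a C).2 = C.2.
Proof. by rewrite /flip; case: ifP. Qed.

Lemma flipK a : involutive (flip a).
Proof.
move=> C; case Ca: (C.2 == a); rewrite /flip ?Ca /= ?Ca //.
case: C Ca => c t /= _; congr (_, _); apply/ffunP => i; rewrite !ffunE.
by rewrite addbA addbb.
Qed.

Definition flip_set a J := flip a @: J.

Lemma flip_setK a : involutive (flip_set a).
Proof.
move=> J; rewrite /flip_set -imset_comp (eq_imset _ (flipK a : _ =1 id)).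
exact: imset_id.
Qed.

Lemma count_flip_set (P : pred scope) a J :
  count [pred C : constraint k n | P C.2] (flip_set a J) =
  count [pred C : constraint k n | P C.2] J.
Proof.
rewrite /count -[RHS](card_imset _ (inv_inj (flipK a))); apply: eq_card => C.
rewrite !inE; apply/andP/imsetP => [[/imsetP[C' C'J ->]] /=|[C' /setIdP[C'J PC'] ->]].
  by rewrite flip_scope => PC'; exists C' => //; rewrite !inE C'J.
by rewrite /= flip_scope; split => //; exact: imset_f.
Qed.

Lemma mult_flip_set a J t : mult (flip_set a J) t = mult J t.
Proof. exact: (count_flip_set (fun t' => t' == t)). Qed.

Lemma chi_flip a C : chi R S (flip a C).1 = (-1) ^+ (a == C.2) * chi R S C.1.
Proof.
rewrite /flip eq_sym; case: ifP => /= _; last by rewrite expr0 mul1r.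
rewrite /chi !(bigD1 i0 i0S) /= ffunE eqxx /= expr1 mulrA; congr (_ * _).
  by case: (C.1 i0) => //=; rewrite ?expr1 ?expr0 ?mulrNN ?mulr1.
by apply: eq_bigr => i /andP[_ /negPf ni]; rewrite ffunE ni.
Qed.

Lemma sign_sum_flip_set a J t :
  sign_sum (flip_set a J) t = (-1) ^+ (a == t) * sign_sum J t.
Proof.
rewrite /sign_sum big_mkcondr /= big_imset /=; last first.
  by move=> C C' _ _; exact: inv_inj (flipK a) C C'.
rewrite mulr_sumr [RHS]big_mkcondr /=; apply: eq_bigr => C _.
by rewrite flip_scope; case: ifP => // /eqP <-; rewrite chi_flip.
Qed.

Lemma sum_mult (P : pred scope) J :
  (\sum_(t | P t) mult J t)%N = count [pred C : constraint k n | P C.2] J.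
Proof.
under eq_bigr => t _ do rewrite /mult count_nat.
rewrite count_nat exchange_big /=; apply: eq_bigr => C _.
rewrite big_mkcond (bigD1 C.2) //= eqxx big1 ?addn0; first by case: (P _).
by move=> t nt; rewrite eq_sym (negPf nt); case: (P t).
Qed.

(** An instance is a set, so constraints with the same scope differ in their sign patterns. *)
Lemma mult_le J t : (mult J t <= 2 ^ k)%N.
Proof.
have -> : (2 ^ k = #|cube k|)%N by rewrite card_ffun card_bool card_ord.
rewrite /mult /count -(card_in_imset (f := fun C : constraint k n => C.1)).
  exact: max_card.
by move=> [c t'] [c' t''] /setIdP[_ /eqP /= ->] /setIdP[_ /eqP /= ->] /= ->.
Qed.

Lemma normr_chi z : `|chi R S z| = 1.
Proof. by rewrite /chi normr_prod big1 // => i _; rewrite normrX normrN1 expr1n. Qed.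

Lemma sign_sum_le J t : `|sign_sum J t| <= (mult J t)%:R.
Proof.
apply: le_trans (ler_norm_sum _ _ _) _.
under eq_bigr => C _ do rewrite normr_chi.
rewrite /mult /count -sum1_card natr_sum.
by rewrite [leLHS]big_mkcond [leRHS]big_mkcond; apply: ler_sum => C _; rewrite !inE.
Qed.

(** Positions outside [S] get the factor 1, so that a monomial becomes a product over all positions
    and splits along any partition of them. *)
Definition masked (i : 'I_k) (j : 'I_n) : {mpoly R[n]} :=
  if i \in S then mvar R j else 1.

Lemma masked_box i j : box_var (masked i j).
Proof. by rewrite /masked; case: ifP => _; [right; exists j|left]. Qed.

Lemma prod_masked_deg h (e : 'I_h -> 'I_k) (u : {ffun 'I_h -> 'I_n}) :
  deg_le (\prod_j masked (e j) (u j)) h.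
Proof.
rewrite -[X in deg_le _ X](size_index_enum_ord h).
by apply: deg_le_prod => j; exact: box_var_deg (masked_box _ _).
Qed.

Definition signed_poly J : {mpoly R[n]} :=
  \sum_(C in J) chi R S C.1 *: \prod_(i in S) mvar R (C.2 i).

Lemma signed_polyE J :
  signed_poly J = \sum_t sign_sum J t *: \prod_i masked i (t i).
Proof.
under eq_bigr => t _ do rewrite /sign_sum scaler_suml big_mkcondr /=.
rewrite exchange_big /=; apply: eq_bigr => C _.
rewrite (bigD1 C.2) //= eqxx [X in _ = _ + X]big1 ?addr0.
  by rewrite [in LHS]big_mkcond.
by move=> t nt; rewrite eq_sym (negPf nt).
Qed.

Lemma box_cone_monomials h d (e : 'I_h -> 'I_k) : (h.*2 <= d)%N ->
  box_cone d (mconst n (n%:R ^+ h : R) -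
    \sum_(u : {ffun 'I_h -> 'I_n}) (\prod_j masked (e j) (u j)) ^+ 2).
Proof.
move=> hd.
have -> : mconst n (n%:R ^+ h : R) = \sum_(u : {ffun 'I_h -> 'I_n}) (1 : {mpoly R[n]}).
  by rewrite sumr_const card_ffun !card_ord -natrX /mconst mpolyC_nat.
rewrite -sumrB; apply: box_cone_sum => u _; apply: box_cone_prod => [|j].
  by rewrite size_index_enum_ord.
exact: masked_box.
Qed.

End ScopeWeights.

(** * Even arity *)

Section SpreadScopes.
Variables (R : realType) (k n : nat) (B K : finType).
Notation scope := {ffun 'I_k -> 'I_n}.
Variables (base : scope -> B) (key : scope -> K).
Implicit Types (J : {set constraint k n}) (x y : R).

Definition scope_light x J :=
  [forall i, forall u,
    (count [pred C : constraint k n | (base C.2 == i) && (key C.2 == u)] J)%:R <= x].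

Definition scope_pairs u u' J : nat :=
  \sum_(t : scope | key t == u)
    \sum_(t' | [&& base t' == base t, key t' == u' & t' != t]) mult J t * mult J t'.

Definition scope_spread x y J :=
  scope_light x J && [forall u, forall u', (scope_pairs u u' J)%:R <= y].

(** The condition sees only multiplicities of scopes. This invariance is what allows the moment
    method to run on the law restricted to spread instances. *)
Lemma scope_spread_flip i0 a x y J :
  scope_spread x y (flip_set i0 a J) = scope_spread x y J.
Proof.
rewrite /scope_spread /scope_light; congr (_ && _).
  apply: eq_forallb => i; apply: eq_forallb => u.
  by rewrite (count_flip_set i0 (fun t => (base t == i) && (key t == u))).
apply: eq_forallb => u; apply: eq_forallb => u'; congr (_%:R <= _).
apply: eq_bigr => t _; apply: eq_bigr => t' _.
by rewrite !mult_flip_set.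
Qed.

(** Constraints with distinct scopes are distinct, whereas [pairs] also counts distinct constraints
    with a common scope. *)
Lemma scope_pairs_le u u' J :
  (scope_pairs u u' J <=
    pairs (fun C : constraint k n => base C.2) (fun C => key C.2) u u' J)%N.
Proof.
apply: (@leq_trans (\sum_(t | key t == u) mult J t *
    count [pred C : constraint k n | [&& base C.2 == base t, key C.2 == u' & C.2 != t]] J)).
  apply: leq_sum => t _; rewrite -big_distrr /=.
  by rewrite (sum_mult (fun t' => [&& base t' == base t, key t' == u' & t' != t])).
rewrite /pairs; under eq_bigr => t _ do rewrite [mult J t]count_nat big_distrl /=.
rewrite exchange_big /= [leqRHS]big_mkcondr /=; apply: leq_sum => C _.
rewrite big_mkcond (bigD1 C.2) //= eqxx mul1n big1 ?addn0; last first.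
  by move=> t nt; rewrite [C.2 == t]eq_sym (negPf nt) mul0n if_same.
case: ifP => // _; apply: subset_leq_card; apply/fintype.subsetP => C'.
rewrite !inE => /and4P[-> -> -> nC] /=.
by apply: contraNneq nC => ->.
Qed.

Lemma scope_spread_tail (p s x y : R) (f1 f0 : nat) : 0 <= p <= 1 -> 0 < s ->
  (forall i u, (#|[pred C : constraint k n | (base C.2 == i) && (key C.2 == u)]| <= f1)%N) ->
  (forall u, (#|[pred C : constraint k n | key C.2 == u]| <= f0)%N) ->
  x = 3 * p * f1%:R + s ->
  y = 2 * (3 * p * f1%:R * (3 * p * f0%:R + s) + x * s) ->
  Pr p (fun J => ~~ scope_spread x y J) <=
    (#|B| * #|K| + #|K| + #|K| * #|K|)%:R * expR (- s).
Proof.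
move=> p01 s0 fib1 fib0 -> ->.
have := spread_tail p01 fib1 fib0 s0; apply: le_trans; apply: Pr_mono => // J.
apply: contra => /andP[l1 /forallP l2]; apply/andP; split => //.
apply/forallP => u; apply/forallP => u'; have /forallP/(_ u') := l2 u.
by apply: le_trans; rewrite ler_nat scope_pairs_le.
Qed.

End SpreadScopes.

(** Inside a fiber of [f], a constraint is determined by its signs and by the value of [g]. *)
Lemma fiber_card (k n : nat) (L Q : finType) (f : {ffun 'I_k -> 'I_n} -> L)
    (g : {ffun 'I_k -> 'I_n} -> Q) u :
  (forall t t', f t = f t' -> g t = g t' -> t = t') ->
  (#|[pred C : constraint k n | f C.2 == u]| <= 2 ^ k * #|Q|)%N.
Proof.
move=> fg.
have -> : (2 ^ k * #|Q| = #|{: cube k * Q}|)%N.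
  by rewrite card_prod card_ffun card_bool card_ord.
rewrite -(card_in_image (f := fun C : constraint k n => (C.1, g C.2))).
  exact: max_card.
move=> [c t] [c' t']; rewrite !inE /= => /eqP ft /eqP ft' [-> gt].
by rewrite (fg t t') // ft.
Qed.

(** Both signs are certified because the Fourier coefficient multiplying the polynomial may have
    either sign. *)
Definition two_sided (R : realType) (k n d : nat) (S : {set 'I_k})
    (J : {set constraint k n}) (b : R) : Prop :=
  box_cone d (mconst n b - signed_poly R S J) /\
  box_cone d (mconst n b + signed_poly R S J).

(** * Tail bounds for missing certificates *)

Section RefutationTails.
Variables (R : realType) (p : R).
Hypothesis p01 : 0 <= p <= 1.

(** The law is set to zero off the flip-invariant event [good]: the symmetry survives, and the row
    bounds hold everywhere on the support. *)
Lemma spectral_tail (k n : nat) (i0 : 'I_k) (Th I1 I2 : finType) (row : Th -> I1)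
    (col : Th -> I2) (supp : Th -> {set {ffun 'I_k -> 'I_n}}) (D : nat)
    (w : {set constraint k n} -> Th -> R) (good : pred {set constraint k n})
    (r1 r2 lambda : R) (q : nat) :
  (forall a J, good (flip_set i0 a J) = good J) -> (0 < D)%N ->
  (forall t, #|supp t| = D \/ forall J, w J t = 0) ->
  (forall a J t, w (flip_set i0 a J) t = (-1) ^+ (a \in supp t) * w J t) ->
  (forall J z, good J -> \sum_(t | incident row col z t) `|w J t| <= r1) ->
  (forall J a z, good J ->
     \sum_(t | incident row col z t && (a \in supp t)) `|w J t| <= r2) ->
  0 <= r1 -> 0 <= r2 -> 0 < lambda ->
  Pr p (fun J => good J && (lambda ^+ q.*2 < \tr (edge_mx row col (w J) ^+ q.*2))) <=
    (4 * q%:R * (r1 * r2) / lambda ^+ 2) ^+ q * #|{: I1 + I2}|%:R.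
Proof.
move=> goodf D0 suppD wf w1 w2 r10 r20 l0.
pose W J : R := if good J then subset_weight p J else 0.
have W0 J : 0 <= W J by rewrite /W; case: ifP => // _; exact: subset_weight_ge0.
have W1 : \sum_J W J <= 1.
  rewrite -(sum_subset_weight (constraint k n) p); apply: ler_sum => J _.
  by rewrite /W; case: ifP => // _; exact: subset_weight_ge0.
have Wgood J : W J != 0 -> good J by rewrite /W; case: ifP => //; rewrite eqxx.
have Wphi a J : W (flip_set i0 a J) = W J.
  by rewrite /W goodf subset_weight_imset //; exact: flipK.
have := edge_tail (row := row) (col := col) q W0 (flip_setK i0) Wphi D0 suppD wf
  (fun J z g => w1 J z (Wgood J g)) (fun J a z g => w2 J a z (Wgood J g)) r10 r20 l0.
have -> : Pr p (fun J => good J && (lambda ^+ q.*2 < \tr (edge_mx row col (w J) ^+ q.*2)))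
        = \sum_(J | lambda ^+ q.*2 < \tr (edge_mx row col (w J) ^+ q.*2)) W J.
  rewrite /Pr big_mkcond [RHS]big_mkcond /=; apply: eq_bigr => J _.
  by rewrite /W; case: (good J) => //=; case: ifP.
move=> tail; apply: le_trans tail _; apply: ler_wpM2l; last by rewrite ler_piMr.
by rewrite exprn_ge0 // divr_ge0 ?sqr_ge0 // !mulr_ge0.
Qed.

Section Even.
Variables (h n : nat).
Notation k := (h + h)%N.
Notation scope := {ffun 'I_(h + h) -> 'I_n}.

Definition lefts (t : scope) : {ffun 'I_h -> 'I_n} := [ffun j => t (lshift h j)].
Definition rights (t : scope) : {ffun 'I_h -> 'I_n} := [ffun j => t (rshift h j)].

Lemma lefts_rights t t' : lefts t = lefts t' -> rights t = rights t' -> t = t'.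
Proof.
move=> /ffunP l /ffunP r; apply/ffunP => i; case: (split_ordP i) => j ->.
  by have := l j; rewrite !ffunE.
by have := r j; rewrite !ffunE.
Qed.

Variables (S : {set 'I_k}) (i0 : 'I_k).
Hypothesis i0S : i0 \in S.

(** The base is trivial, so lightness bounds the number of constraints sharing a half. *)
Definition even_good (x y : R) (J : {set constraint k n}) :=
  scope_spread (fun=> tt) lefts x y J && scope_spread (fun=> tt) rights x y J.

Lemma even_certificate (lambda : R) r J : 0 < lambda ->
  \tr (edge_mx lefts rights (sign_sum R S J) ^+ (2 ^ r).*2) <= lambda ^+ (2 ^ r).*2 ->
  two_sided (2 * k) S J (lambda * n%:R ^+ h).
Proof.
move=> l0 trle.
pose e1 (j : 'I_h) := lshift h j; pose e2 (j : 'I_h) := rshift h j.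
pose y1 (u : {ffun 'I_h -> 'I_n}) := \prod_j masked R S (e1 j) (u j).
pose y2 (u : {ffun 'I_h -> 'I_n}) := \prod_j masked R S (e2 j) (u j).
have y1d u : deg_le (y1 u) h by exact: prod_masked_deg.
have y2d u : deg_le (y2 u) h by exact: prod_masked_deg.
have hk : (h.*2 <= 2 * k)%N by rewrite mul2n leq_double leq_addr.
have polyE : signed_poly R S J = \sum_t sign_sum R S J t *: (y1 (lefts t) * y2 (rights t)).
  rewrite signed_polyE; apply: eq_bigr => t _; rewrite big_split_ord /=.
  by congr (_ *: (_ * _)); apply: eq_bigr => j _; rewrite ffunE.
have c1 := @box_cone_monomials R k n S h (2 * k) e1 hk.
have c2 := @box_cone_monomials R k n S h (2 * k) e2 hk.
have l20 : 0 <= lambda / 2 by rewrite divr_ge0 // ltW.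
have c12 := box_coneZ l20 (box_coneD c1 c2).
have main (F : {mpoly R[n]}) :
    box_cone (2 * k) ((lambda / 2) *: (\sum_u y1 u ^+ 2 + \sum_v y2 v ^+ 2) - F) ->
    box_cone (2 * k) (mconst n (lambda * n%:R ^+ h) - F).
  move=> cF; have := box_coneD c12 cF.
  congr box_cone; rewrite addrA; congr (_ - _).
  rewrite -scalerDr addrACA !subrK -mulr2n -mul_mpolyC /mconst -rmorphMn -rmorphM /=.
  by congr mpolyC; field.
split; first by rewrite polyE; apply/main/(edge_cone y1d y2d hk l0 trle).
rewrite -[signed_poly _ _ _]opprK; apply: main.
have -> : - signed_poly R S J =
    \sum_t (- sign_sum R S J t) *: (y1 (lefts t) * y2 (rights t)).
  by rewrite polyE -sumrN; apply: eq_bigr => t _; rewrite scaleNr.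
by apply: (edge_cone y1d y2d hk l0 (r := r)); rewrite trace_edge_mxN.
Qed.

(** An edge is a scope supported on itself, so [D = 1]; a flip touches a single entry, of size at
    most [2 ^ k]. *)
Lemma even_tail (x y lambda : R) r : 0 <= x -> 0 < lambda ->
  Pr p (fun J => even_good x y J &&
          ~~ `[< two_sided (2 * k) S J (lambda * n%:R ^+ h) >]) <=
    (4 * (2 ^ r)%:R * (x * (2 ^ k)%:R) / lambda ^+ 2) ^+ (2 ^ r) * (2 * n%:R ^+ h).
Proof.
move=> x0 l0.
have -> : 2 * n%:R ^+ h = #|{: {ffun 'I_h -> 'I_n} + {ffun 'I_h -> 'I_n}}|%:R :> R.
  by rewrite card_sum card_ffun !card_ord natrD natrX mulr_natl mulr2n.
apply: le_trans (@spectral_tail k n i0 scope _ _ lefts rights (fun t => [set t]%SET) 1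
  (sign_sum R S) (even_good x y) x (2 ^ k)%:R lambda (2 ^ r) _ _ _ _ _ _ _ _ _) => //.
- apply: Pr_mono => // J /andP[-> /asboolP nc] /=; case: ltP => // trle.
  by exfalso; apply: nc; exact: even_certificate trle.
- by move=> a J; rewrite /even_good !scope_spread_flip.
- by move=> t; left; exact: cards1.
- by move=> a J t; rewrite sign_sum_flip_set // inE.
- move=> J z /andP[/andP[/forallP/(_ tt) /forallP gl _] /andP[/forallP/(_ tt) /forallP gr _]].
  have sum_le (P : pred scope) : \sum_(t | P t) `|sign_sum R S J t| <=
      (count [pred C : constraint k n | P C.2] J)%:R.
    by rewrite -sum_mult natr_sum; apply: ler_sum => t _; exact: sign_sum_le.
  case: z => [u|v]; apply: le_trans (sum_le _) _.
    exact: le_trans _ (gl u).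
  exact: le_trans _ (gr v).
- move=> J a z _; apply: (@le_trans _ _ (\sum_(t | t == a) `|sign_sum R S J t|)).
    rewrite big_mkcond [leRHS]big_mkcond /=; apply: ler_sum => t _.
    by rewrite inE eq_sym; case: (t == a); rewrite ?andbF // andbT; case: ifP.
  rewrite big_pred1_eq; apply: le_trans (sign_sum_le _ _ _ _) _.
  by rewrite ler_nat mult_le.
Qed.

End Even.
End RefutationTails.

(** * Odd arity *)

Section OddCertificate.
Variables (R : realType) (h n : nat).
Notation k := (h + h).+1.
Notation scope := {ffun 'I_(h + h).+1 -> 'I_n}.
Notation half := {ffun 'I_h -> 'I_n}.

(** Position [ord0] carries the variable singled out by the slices; the other [2h] positions are cut
    into two halves. *)
Definition pos1 (j : 'I_h) : 'I_k := lift ord0 (lshift h j).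
Definition pos2 (j : 'I_h) : 'I_k := lift ord0 (rshift h j).
Definition mid (t : scope) : 'I_n := t ord0.
Definition part1 (t : scope) : half := [ffun j => t (pos1 j)].
Definition part2 (t : scope) : half := [ffun j => t (pos2 j)].

Lemma parts_inj t t' :
  mid t = mid t' -> part1 t = part1 t' -> part2 t = part2 t' -> t = t'.
Proof.
move=> m /ffunP l /ffunP r; apply/ffunP => i.
case: (unliftP ord0 i) => [j ->|-> //]; case: (split_ordP j) => j' ->.
  by have := l j'; rewrite !ffunE.
by have := r j'; rewrite !ffunE.
Qed.

Variable S : {set 'I_k}.
Implicit Types (J : {set constraint k n}).

Definition linked (t : scope * scope) : bool := (t.2 != t.1) && (mid t.2 == mid t.1).

Definition pair_weight J (t : scope * scope) : R :=
  if linked t then sign_sum R S J t.1 * sign_sum R S J t.2 else 0.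

(** Rows collect the first halves of both scopes and columns the second halves. With a whole scope
    on one side, all partners of a constraint would fall into one row; here a row admits only
    partners with a prescribed half. *)
Definition prow (t : scope * scope) : half * half := (part1 t.1, part1 t.2).
Definition pcol (t : scope * scope) : half * half := (part2 t.1, part2 t.2).

Definition mono1 (u : half) : {mpoly R[n]} := \prod_j masked R S (pos1 j) (u j).
Definition mono2 (u : half) : {mpoly R[n]} := \prod_j masked R S (pos2 j) (u j).
Definition slice J (i : 'I_n) : {mpoly R[n]} :=
  \sum_(t | mid t == i) sign_sum R S J t *: (mono1 (part1 t) * mono2 (part2 t)).

Lemma box_cone_prod2 (d : nat) (e e' : 'I_h -> 'I_k) (u u' : half) : ((h + h).*2 <= d)%N ->
  box_cone d (1 - (\prod_j masked R S (e j) (u j) * \prod_j masked R S (e' j) (u' j)) ^+ 2).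
Proof.
move=> hd.
pose F (x : 'I_h + 'I_h) : {mpoly R[n]} := match x with
  inl j => masked R S (e j) (u j) | inr j => masked R S (e' j) (u' j) end.
have -> : \prod_j masked R S (e j) (u j) * \prod_j masked R S (e' j) (u' j)
        = \prod_x F x by rewrite big_sumType.
apply: box_cone_prod; last by case=> j; exact: masked_box.
by rewrite [index_enum _]unlock -enumT -cardE card_sum !card_ord.
Qed.

Lemma signed_poly_slices J :
  signed_poly R S J = \sum_i masked R S ord0 i * slice J i.
Proof.
rewrite signed_polyE (partition_big mid xpredT) //=; apply: eq_bigr => i _.
rewrite /slice mulr_sumr; apply: eq_bigr => t /eqP <-.
rewrite -scalerAr big_ord_recl big_split_ord /=; congr (_ *: (_ * (_ * _))).
  by apply: eq_bigr => j _; rewrite ffunE.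
by apply: eq_bigr => j _; rewrite ffunE.
Qed.

(* The diagonal [t' = t] is kept apart: it is controlled by the size of [J] alone,
   whereas an off-diagonal term changes sign under the flips at [t] and at [t']. *)
Lemma sum_slice_sqr J :
  \sum_i slice J i ^+ 2 =
    \sum_t (sign_sum R S J t ^+ 2) *: (mono1 (part1 t) * mono2 (part2 t)) ^+ 2 +
    \sum_t pair_weight J t *:
      ((mono1 (prow t).1 * mono1 (prow t).2) * (mono2 (pcol t).1 * mono2 (pcol t).2)).
Proof.
pose m t := mono1 (part1 t) * mono2 (part2 t).
pose s t := sign_sum R S J t.
transitivity (\sum_t \sum_(t' | mid t' == mid t) (s t * s t') *: (m t * m t')).
  rewrite [RHS](partition_big mid xpredT) //=; apply: eq_bigr => i _.
  rewrite expr2 {1}/slice mulr_suml; apply: eq_bigr => t /eqP ti.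
  rewrite ti /slice mulr_sumr; apply: eq_bigr => t' _.
  by rewrite -scalerAl -scalerAr scalerA.
have -> : \sum_t pair_weight J t *:
      ((mono1 (prow t).1 * mono1 (prow t).2) * (mono2 (pcol t).1 * mono2 (pcol t).2))
  = \sum_t \sum_(t' | (mid t' == mid t) && (t' != t)) (s t * s t') *: (m t * m t').
  under [RHS]eq_bigr => t _ do rewrite big_mkcond.
  rewrite pair_bigA /=; apply: eq_bigr => -[t t'] _ /=.
  rewrite /pair_weight /linked /= andbC; case: ifP => _; last by rewrite scale0r.
  by congr (_ *: _); rewrite /m; ring.
rewrite -big_split /=; apply: eq_bigr => t _.
by rewrite (bigD1 t) //= expr2 [m t * m t]expr2.
Qed.

(** One factor of each square is at most [2 ^ k]; the other sums to at most the number of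
    constraints. *)
Lemma sign_sum_sqr_le J : \sum_t sign_sum R S J t ^+ 2 <= (2 ^ k)%:R * #|J|%:R.
Proof.
have -> : #|J|%:R = \sum_t (mult J t)%:R :> R.
  rewrite -natr_sum (sum_mult xpredT) /count; congr _%:R.
  by apply: eq_card => C; rewrite !inE andbT.
rewrite mulr_sumr; apply: ler_sum => t _; rewrite -real_normK ?num_real // expr2.
by apply: ler_pM => //; [apply: le_trans (sign_sum_le _ _ _ _) _; rewrite ler_nat mult_le
  |exact: sign_sum_le].
Qed.

(* Writing the polynomial as [sum_i v_i g_i] with slices [g_i], the square
   [sum_i (mu v_i -+ g_i)^2] reduces the bound to one on [sum_i g_i^2]. *)
Lemma odd_certificate (lambda mu m : R) r J : 0 < lambda -> 0 < mu ->
  #|J|%:R <= m ->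
  \tr (edge_mx prow pcol (pair_weight J) ^+ (2 ^ r).*2) <= lambda ^+ (2 ^ r).*2 ->
  two_sided (2 * k) S J
    (mu / 2 * n%:R + (2 * mu)^-1 * ((2 ^ k)%:R * m + lambda * n%:R ^+ (h + h))).
Proof.
move=> l0 m0 Jm trle.
have k2 : ((h + h).*2 <= 2 * k)%N by rewrite mul2n leq_double.
have k3 : (k.*2 <= 2 * k)%N by rewrite mul2n.
pose y1 (u : half * half) := mono1 u.1 * mono1 u.2.
pose y2 (u : half * half) := mono2 u.1 * mono2 u.2.
have y1d u : deg_le (y1 u) (h + h) by apply: deg_leM; exact: prod_masked_deg.
have y2d u : deg_le (y2 u) (h + h) by apply: deg_leM; exact: prod_masked_deg.
have cN : (n%:R ^+ (h + h) : R) = #|{: half * half}|%:R.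
  by rewrite card_prod card_ffun !card_ord -natrX -expnD.
have c1 : box_cone (2 * k) (mconst n (n%:R ^+ (h + h)) - \sum_u y1 u ^+ 2).
  have -> : mconst n (n%:R ^+ (h + h) : R) = \sum_(u : half * half) (1 : {mpoly R[n]}).
    by rewrite sumr_const cN /mconst mpolyC_nat.
  by rewrite -sumrB; apply: box_cone_sum => u _; exact: box_cone_prod2.
have c2 : box_cone (2 * k) (mconst n (n%:R ^+ (h + h)) - \sum_u y2 u ^+ 2).
  have -> : mconst n (n%:R ^+ (h + h) : R) = \sum_(u : half * half) (1 : {mpoly R[n]}).
    by rewrite sumr_const cN /mconst mpolyC_nat.
  by rewrite -sumrB; apply: box_cone_sum => u _; exact: box_cone_prod2.
have l20 : 0 <= lambda / 2 by rewrite divr_ge0 // ltW.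
have coff : box_cone (2 * k) (mconst n (lambda * n%:R ^+ (h + h)) -
    \sum_t pair_weight J t *: (y1 (prow t) * y2 (pcol t))).
  have := box_coneD (box_coneZ l20 (box_coneD c1 c2)) (edge_cone y1d y2d k2 l0 trle).
  congr box_cone; rewrite addrA; congr (_ - _).
  rewrite -scalerDr addrACA !subrK -mulr2n -mul_mpolyC /mconst -rmorphMn -rmorphM /=.
  by congr mpolyC; field.
have cdiag : box_cone (2 * k) (mconst n ((2 ^ k)%:R * m) -
    \sum_t (sign_sum R S J t ^+ 2) *: (mono1 (part1 t) * mono2 (part2 t)) ^+ 2).
  pose s2 := \sum_t sign_sum R S J t ^+ 2.
  have -> : mconst n ((2 ^ k)%:R * m) -
    \sum_t (sign_sum R S J t ^+ 2) *: (mono1 (part1 t) * mono2 (part2 t)) ^+ 2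
    = mconst n ((2 ^ k)%:R * m - s2) +
    \sum_t (sign_sum R S J t ^+ 2) *: (1 - (mono1 (part1 t) * mono2 (part2 t)) ^+ 2).
    under [in RHS]eq_bigr => t _ do rewrite scalerBr.
    rewrite sumrB -scaler_suml -/s2 alg_mpolyC /mconst rmorphB /= addrA; congr (_ - _).
    by rewrite subrK.
  apply: box_coneD; last first.
    apply: box_cone_sum => t _; apply: box_coneZ; first exact: sqr_ge0.
    exact: box_cone_prod2.
  apply: box_coneC; rewrite subr_ge0; apply: le_trans (sign_sum_sqr_le J) _.
  by apply: ler_wpM2l.
have csq : box_cone (2 * k) (mconst n ((2 ^ k)%:R * m + lambda * n%:R ^+ (h + h))
    - \sum_i slice J i ^+ 2).
  have := box_coneD cdiag coff; congr box_cone.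
  by rewrite sum_slice_sqr /mconst rmorphD /= opprD addrACA.
have cmid : box_cone (2 * k) (mconst n (n%:R : R) - \sum_i masked R S ord0 i ^+ 2).
  have -> : mconst n (n%:R : R) = \sum_(i < n) (1 : {mpoly R[n]}).
    by rewrite sumr_const card_ord /mconst mpolyC_nat.
  rewrite -sumrB; apply: box_cone_sum => i _.
  have := @box_cone_prod R n (2 * k) 'I_1 [:: ord0] (fun=> masked R S ord0 i).
  by rewrite big_seq1; apply; [by rewrite mul2n leq_double|move=> _; exact: masked_box].
have slice_deg i : deg_le (slice J i) k.
  apply: deg_le_sum => t _; apply: deg_leZ; apply: (@deg_leW _ _ (h + h)) => //.
  by apply: deg_leM; exact: prod_masked_deg.
have main (b : bool) : box_cone (2 * k)
    (mconst n (mu / 2 * n%:R + (2 * mu)^-1 * ((2 ^ k)%:R * m + lambda * n%:R ^+ (h + h)))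
     - (-1) ^+ b * signed_poly R S J).
  have cS : box_cone (2 * k) (\sum_i (mu *: masked R S ord0 i - (-1) ^+ b * slice J i) ^+ 2).
    apply: box_cone_sum => i _; apply: box_cone_sqr k3 _; apply: deg_leD.
      by apply: deg_leZ; apply: deg_leW (box_var_deg (masked_box _ _ _ _)).
    by apply: deg_leN; rewrite mulr_sign; case: b; [apply: deg_leN|].
  have i0' : 0 <= (2 * mu)^-1 by rewrite invr_ge0 mulr_ge0 // ltW.
  have mu20 : 0 <= mu / 2 by rewrite divr_ge0 // ltW.
  (* The squares of the [v_i] cancel against those from [cmid], the squares of the slices against
     those from [csq]; only the cross term, the signed polynomial, remains. *)
  have := box_coneD (box_coneZ mu20 cmid) (box_coneD (box_coneZ i0' cS) (box_coneZ i0' csq)).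
  congr box_cone.
  set c := (2 ^ k)%:R * m + lambda * n%:R ^+ (h + h).
  have -> : \sum_i (mu *: masked R S ord0 i - (-1) ^+ b * slice J i) ^+ 2
    = mu ^+ 2 *: \sum_i masked R S ord0 i ^+ 2 - (2 * mu) *: ((-1) ^+ b * signed_poly R S J)
      + \sum_i slice J i ^+ 2.
    rewrite signed_poly_slices mulr_sumr !scaler_sumr -sumrB -big_split /=.
    apply: eq_bigr => i _.
    have sb : ((-1) ^+ b : {mpoly R[n]}) ^+ 2 = 1 by rewrite sqrr_sign.
    rewrite -!mul_mpolyC rmorphXn rmorphM /= mpolyC_nat sqrrB [(_ * slice J i) ^+ 2]exprMn sb.
    by ring.
  set V := \sum_i masked R S ord0 i ^+ 2; set G := \sum_i slice J i ^+ 2.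
  set F := (-1) ^+ b * _.
  have ring1 (x y z t a c' : {mpoly R[n]}) :
      x * (a - V) + (y * (z * V - t * F + G) + y * (c' - G))
      = x * (a - V) + (y * z) * V - (y * t) * F + y * c' by ring.
  rewrite -!mul_mpolyC ring1 /mconst -!rmorphM /=.
  have -> : (2 * mu)^-1 * mu ^+ 2 = mu / 2 by field; rewrite gt_eqF.
  rewrite mulVf ?gt_eqF ?mulr_gt0 // mul1r mulrBr subrK -rmorphM /= addrAC -rmorphD /=.
  by [].
split; first by have := main false; rewrite expr0 mul1r.
by have := main true; rewrite expr1 mulN1r opprK.
Qed.

End OddCertificate.

Section OddTail.
Variables (R : realType) (p : R).
Hypothesis p01 : 0 <= p <= 1.
Variables (h n : nat).
Notation k := (h + h).+1.
Notation scope := {ffun 'I_(h + h).+1 -> 'I_n}.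
Notation half := {ffun 'I_h -> 'I_n}.
Variables (S : {set 'I_k}) (i0 : 'I_k).
Hypothesis i0S : i0 \in S.
Implicit Types (J : {set constraint k n}).

Lemma pair_weight_flip a J t :
  pair_weight R S (flip_set i0 a J) t =
    (-1) ^+ (a \in [set t.1; t.2]%SET) * pair_weight R S J t.
Proof.
rewrite /pair_weight; case: ifP => [/andP[nt _]|_]; last by rewrite mulr0.
rewrite !sign_sum_flip_set // !inE.
have [->|n1] := eqVneq a t.1; last by rewrite /= expr0 mul1r mulrCA.
by rewrite eq_sym (negPf nt) /= expr0 mul1r mulrA.
Qed.

Lemma pair_weight_le J t :
  `|pair_weight R S J t| <= (linked t)%:R * ((mult J t.1)%:R * (mult J t.2)%:R).
Proof.
rewrite /pair_weight; case: ifP => _; last by rewrite normr0 mul0r.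
by rewrite mul1r normrM; apply: ler_pM => //; exact: sign_sum_le.
Qed.

Section Key.
Variables (key : scope -> half) (x y : R) (J : {set constraint k n}).
Hypothesis J_spread : scope_spread (@mid h n) key x y J.

Lemma pair_weight_rows u u' :
  \sum_(t | (key t.1 == u) && (key t.2 == u')) `|pair_weight R S J t| <= y.
Proof.
have /andP[_ /forallP/(_ u) /forallP/(_ u')] := J_spread; apply: le_trans.
apply: (@le_trans _ _ (\sum_(t | (key t.1 == u) && (key t.2 == u'))
   (linked t)%:R * ((mult J t.1)%:R * (mult J t.2)%:R))).
  by apply: ler_sum => t _; exact: pair_weight_le.
rewrite /scope_pairs natr_sum big_mkcond [leRHS]big_mkcond /=.
rewrite -(pair_bigA _ (fun t t' => if (key t == u) && (key t' == u') then
   (linked (t, t'))%:R * ((mult J t)%:R * (mult J t')%:R) else 0)) /=.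
apply: ler_sum => t _; case: (key t == u) => /=; last by rewrite big1.
rewrite natr_sum [leRHS]big_mkcond /=; apply: ler_sum => t' _.
rewrite /linked /=; case: (key t' == u') => /=; last by rewrite andbF.
by rewrite andbC; case: ifP => _; rewrite ?natrM ?mul1r ?mul0r.
Qed.

Lemma light_sum i u : \sum_(t | (mid t == i) && (key t == u)) (mult J t)%:R <= x.
Proof.
rewrite -natr_sum (sum_mult (fun t => (mid t == i) && (key t == u))).
by have /andP[/forallP/(_ i) /forallP/(_ u)] := J_spread.
Qed.

(** One component of the pair is [a], with multiplicity at most [2 ^ k]. The other shares the middle
    variable of [a] and has a prescribed key, so lightness bounds it. The 2 accounts for the two
    places of [a]. *)
Lemma pair_weight_star a u u' : 0 <= x ->
  \sum_(t | (key t.1 == u) && (key t.2 == u') && (a \in [set t.1; t.2]%SET))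
     `|pair_weight R S J t| <= 2 * (2 ^ k)%:R * x.
Proof.
move=> x0.
pose A (t : scope * scope) : R := (t.1 == a)%:R *
  (((mid t.2 == mid a) && (key t.2 == u'))%:R * ((mult J a)%:R * (mult J t.2)%:R)).
pose B (t : scope * scope) : R := (t.2 == a)%:R *
  (((mid t.1 == mid a) && (key t.1 == u))%:R * ((mult J a)%:R * (mult J t.1)%:R)).
have le1 v : (mult J a)%:R * \sum_(t | (mid t == mid a) && (key t == v)) (mult J t)%:R
    <= (2 ^ k)%:R * x.
  by apply: ler_pM; rewrite ?ler_nat ?mult_le ?light_sum // sumr_ge0.
apply: (@le_trans _ _ (\sum_t (A t + B t))).
  rewrite big_mkcond; apply: ler_sum => t _.
  have A0 : 0 <= A t by rewrite /A !mulr_ge0.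
  have B0 : 0 <= B t by rewrite /B !mulr_ge0.
  case: ifP => [|_]; last exact: addr_ge0.
  rewrite !inE => /andP[/andP[k1 k2] /orP[/eqP at1|/eqP at2]].
    apply: ler_wpDr => //; apply: le_trans (pair_weight_le J t) _.
    rewrite /A /linked -at1 eqxx k2 andbT mul1r.
    apply: ler_wpM2r; first by rewrite mulr_ge0.
    by rewrite ler_nat; case: (mid t.2 == _); case: (t.2 != _).
  apply: ler_wpDl => //; apply: le_trans (pair_weight_le J t) _.
  rewrite /B at2 eqxx k1 /linked andbT mul1r [mid _ == _]eq_sym [(mult J t.1)%:R * _]mulrC.
  apply: ler_wpM2r; first by rewrite mulr_ge0.
  by rewrite ler_nat; case: (mid t.1 == _); case: (_ != _).
rewrite big_split /=.
have -> : \sum_t A t =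
    (mult J a)%:R * \sum_(t | (mid t == mid a) && (key t == u')) (mult J t)%:R.
  rewrite -(pair_bigA _ (fun t t' => A (t, t'))) /= (bigD1 a) //= [X in _ + X]big1 ?addr0.
    rewrite mulr_sumr [RHS]big_mkcond; apply: eq_bigr => t _.
    by rewrite /A /= eqxx mul1r; case: ifP => _; rewrite ?mul1r ?mul0r.
  by move=> t nt; apply: big1 => t' _; rewrite /A /= (negPf nt) mul0r.
have -> : \sum_t B t =
    (mult J a)%:R * \sum_(t | (mid t == mid a) && (key t == u)) (mult J t)%:R.
  rewrite -(pair_bigA _ (fun t t' => B (t, t'))) exchange_big /= (bigD1 a) //=.
  rewrite [X in _ + X]big1 ?addr0.
    rewrite mulr_sumr [RHS]big_mkcond; apply: eq_bigr => t _.
    by rewrite /B /= eqxx mul1r; case: ifP => _; rewrite ?mul1r ?mul0r.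
  by move=> t nt; apply: big1 => t' _; rewrite /B /= (negPf nt) mul0r.
have -> : 2 * (2 ^ k)%:R * x = (2 ^ k)%:R * x + (2 ^ k)%:R * x by ring.
by apply: lerD; exact: le1.
Qed.

End Key.

Definition odd_good (m x y : R) J :=
  [&& #|J|%:R <= m, scope_spread (@mid h n) (@part1 h n) x y J
    & scope_spread (@mid h n) (@part2 h n) x y J].

(** A linked pair contains two distinct scopes, so [D = 2]; diagonal pairs have smaller support but
    weight 0. *)
Lemma odd_tail (m x y lambda mu : R) r :
  0 <= x -> 0 <= y -> 0 < lambda -> 0 < mu ->
  Pr p (fun J => odd_good m x y J && ~~ `[< two_sided (2 * k) S J
    (mu / 2 * n%:R + (2 * mu)^-1 * ((2 ^ k)%:R * m + lambda * n%:R ^+ (h + h))) >]) <=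
  (4 * (2 ^ r)%:R * (y * (2 * (2 ^ k)%:R * x)) / lambda ^+ 2) ^+ (2 ^ r)
    * (2 * n%:R ^+ (h + h)).
Proof.
move=> x0 y0 l0 m0.
have -> : 2 * n%:R ^+ (h + h) = #|{: (half * half) + (half * half)}|%:R :> R.
  by rewrite card_sum card_prod card_ffun !card_ord natrD -expnD natrX mulr_natl mulr2n.
apply: le_trans (@spectral_tail R p p01 k n i0 (scope * scope)%type _ _ (@prow h n) (@pcol h n)
  (fun t => [set t.1; t.2]%SET) 2 (pair_weight R S) (odd_good m x y) y
  (2 * (2 ^ k)%:R * x) lambda (2 ^ r) _ _ _ _ _ _ _ _ _) => //.
- apply: Pr_mono => // J /andP[/[dup] good -> /asboolP nc] /=; case: ltP => // trle.
  by exfalso; apply: nc; apply: odd_certificate trle => //; case/and3P: good.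
- move=> a J; rewrite /odd_good !scope_spread_flip; congr (_ && _).
  by congr (_%:R <= _); apply: card_imset; apply: inv_inj; exact: flipK.
- move=> t; have [tt|nt] := eqVneq t.2 t.1.
    by right=> J; rewrite /pair_weight /linked tt eqxx.
  by left; rewrite cards2 eq_sym nt.
- exact: pair_weight_flip.
- move=> J [[u u']|[u u']] /and3P[_ s1 s2].
    apply: le_trans (pair_weight_rows s1 u u'); rewrite le_eqVlt; apply/orP; left; apply/eqP.
    by apply: eq_bigl => t; rewrite /= xpair_eqE.
  apply: le_trans (pair_weight_rows s2 u u'); rewrite le_eqVlt; apply/orP; left; apply/eqP.
  by apply: eq_bigl => t; rewrite /= xpair_eqE.
- move=> J a [[u u']|[u u']] /and3P[_ s1 s2].
    apply: le_trans (pair_weight_star s1 a u u' x0); rewrite le_eqVlt; apply/orP; left; apply/eqP.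
    by apply: eq_bigl => t; rewrite /= xpair_eqE.
  apply: le_trans (pair_weight_star s2 a u u' x0); rewrite le_eqVlt; apply/orP; left; apply/eqP.
  by apply: eq_bigl => t; rewrite /= xpair_eqE.
- by rewrite !mulr_ge0.
Qed.

End OddTail.

(** * Asymptotics *)

Lemma card_ord_sets k : #|{set 'I_k}| = (2 ^ k)%N.
Proof. by rewrite -cardsT -powersetT card_powerset cardsT card_ord. Qed.

Section Asymptotics.
Variable R : realType.

Lemma exists_pow2 (L : R) : 1 <= L -> exists r, L <= (2 ^ r)%:R <= 3 * L.
Proof.
move=> L1.
have ex : exists r, L <= (2 ^ r)%:R.
  exists (Num.truncn L).+1; apply: le_trans (ltW (truncnS_gt L)) _.
  by rewrite ler_nat ltnW // ltn_expl.
case: (ex_minnP ex) => r Lr rmin; exists r; rewrite Lr /=.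
case: r Lr rmin => [_ _|r _ rmin]; first by rewrite expn0; lra.
have : (2 ^ r)%:R < L by rewrite ltNge; apply/negP => /rmin; rewrite ltnn.
by rewrite expnS natrM; lra.
Qed.

Lemma expR_lnn (n m : nat) : (0 < n)%N -> expR (- (m%:R * ln n%:R)) = n%:R ^- m :> R.
Proof. by move=> n0; rewrite expRN expRM_natl lnK // posrE ltr0n. Qed.

(* With at least [ln n] steps, a decay factor [e^-(k+1)] per step beats the
   dimension [2 n^j] of the matrices. *)
Lemma tail_small (n k j q : nat) (rho : R) : (0 < n)%N -> (j <= k)%N ->
  ln n%:R <= q%:R :> R -> 0 <= rho -> rho <= expR (- k.+1%:R) ->
  rho ^+ q * (2 * n%:R ^+ j) <= 2 / n%:R.
Proof.
move=> n0 jk Lq rho0 rhoe.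
have n0' : 0 < n%:R :> R by rewrite ltr0n.
have le1 : rho ^+ q <= n%:R ^- k.+1.
  apply: (@le_trans _ _ (expR (- k.+1%:R) ^+ q)); first by apply: lerXn2r; rewrite ?nnegrE ?expR_ge0.
  rewrite -expRM_natl -(expR_lnn k.+1 n0) ler_expR mulrN lerN2 mulrC.
  by apply: ler_wpM2r.
have le2 : n%:R ^+ j <= n%:R ^+ k :> R by apply: ler_weXn2l => //; rewrite ler1n.
apply: (@le_trans _ _ (n%:R ^- k.+1 * (2 * n%:R ^+ k))).
  apply: ler_pM; rewrite ?exprn_ge0 // ?mulr_ge0 ?exprn_ge0 ?ler0n //.
  by apply: ler_wpM2l.
rewrite le_eqVlt; apply/orP; left; apply/eqP.
by rewrite exprS; field; rewrite ?expf_neq0 gt_eqF.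
Qed.

(** The deviation [(k + 1) ln n] beats, by a factor [n], a union bound over at most [3 n^k]
    events. *)
Lemma spread_small (n k a : nat) (e : R) : (0 < n)%N -> (a <= 3 * n ^ k)%N ->
  e = expR (- (k.+1%:R * ln n%:R)) -> a%:R * e <= 3 / n%:R.
Proof.
move=> n0 ak ->; rewrite expR_lnn //.
have n0' : 0 < n%:R :> R by rewrite ltr0n.
apply: (@le_trans _ _ ((3 * n ^ k)%:R * n%:R ^- k.+1)).
  by apply: ler_wpM2r; rewrite ?invr_ge0 ?exprn_ge0 ?ler0n // ler_nat.
rewrite le_eqVlt; apply/orP; left; apply/eqP.
by rewrite natrM natrX exprS; field; rewrite ?expf_neq0 gt_eqF.
Qed.

Lemma leq_add3 (a b c d : nat) :
  (a <= d)%N -> (b <= d)%N -> (c <= d)%N -> (a + b + c <= 3 * d)%N.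
Proof. lia. Qed.

Lemma two_sided_mono (k n d : nat) (S : {set 'I_k}) (J : {set constraint k n}) (b b' : R) :
  b <= b' -> two_sided d S J b -> two_sided d S J b'.
Proof.
move=> bb [c1 c2]; have c : box_cone d (mconst n (b' - b)).
  by apply: box_coneC; rewrite subr_ge0.
have bE : mconst n b' = mconst n (b' - b) + mconst n b.
  by rewrite /mconst -rmorphD /= subrK.
by split; rewrite bE -addrA; exact: box_coneD.
Qed.

Definition all_two_sided (k n : nat) (b : R) (J : {set constraint k n}) : Prop :=
  forall S : {set 'I_k}, S != finset.set0 -> two_sided (2 * k) S J b.

Lemma all_two_sided_tail (k n : nat) (p b e0 e1 : R) (good : pred {set constraint k n}) :
  0 <= p <= 1 -> 0 <= e1 ->
  Pr p (fun J => ~~ good J) <= e0 ->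
  (forall (S : {set 'I_k}) (i0 : 'I_k), i0 \in S ->
     Pr p (fun J => good J && ~~ `[< two_sided (2 * k) S J b >]) <= e1) ->
  Pr p (fun J : {set constraint k n} => ~~ `[< all_two_sided b J >]) <= e0 + (2 ^ k)%:R * e1.
Proof.
move=> p01 e10 bad tails.
pose F (S : {set 'I_k}) (J : {set constraint k n}) :=
  [&& S != finset.set0, good J & ~~ `[< two_sided (2 * k) S J b >]].
have PF : Pr p (fun J => [exists S, F S J]) <= #|{set 'I_k}|%:R * e1.
  apply: (Pr_exists p01 (F := F)) => // S.
  have [->|/set0Pn[i0 i0S]] := eqVneq S finset.set0.
    by rewrite /Pr big_pred0 // => J; rewrite /F eqxx.
  apply: le_trans (tails S i0 i0S); apply: Pr_mono => // J.
  by rewrite /F => /and3P[_ -> ->].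
rewrite card_ord_sets in PF.
apply: le_trans (lerD bad PF); apply: Pr_union => // J /asboolP nall.
have [gJ|//] := boolP (good J); apply/existsP; apply: contrapT => nF; apply: nall => S nS.
apply: contrapT => nc; apply: nF; exists S; rewrite /F nS gJ /=.
exact/asboolP.
Qed.

(** With [D = M / n^h], rows are of order [D], flips of order 1 and [lambda = eta D], so a moment
    step gains a factor of order [ln n / D]; a large [c] brings it below [e^-(k+1)]. *)
Lemma all_two_sided_even (h : nat) (eta : R) : 0 < eta ->
  exists2 c : R, 0 < c & forall (n : nat) (p : R), 0 <= p <= 1 -> 1 <= ln n%:R :> R ->
    c * ln n%:R * n%:R ^+ h <= mean_size (h + h) n p ->
    Pr p (fun J : {set constraint (h + h) n} =>
            ~~ `[< all_two_sided (eta * mean_size (h + h) n p) J >])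
      <= (6 + 2 * (2 ^ (h + h))%:R) / n%:R.
Proof.
move=> eta0; set k := (h + h)%N; pose K : R := k.+1%:R.
pose E : R := expR k.+1%:R.
have E0 : 0 < E by exact: expR_gt0.
(* 12 is 4 times the 3 of [q <= 3 ln n], [3 + K] bounds [x / D], [2 ^ k] is the flip bound and [E]
   the inverse of the decay wanted per step. *)
pose c1 : R := 12 * (3 + K) * (2 ^ k)%:R / eta ^+ 2 * E.
have K0 : 0 < K by rewrite ltr0n.
have pk0 : 0 < (2 ^ k)%:R :> R by rewrite ltr0n expn_gt0.
have c10 : 0 < c1 by rewrite /c1 !mulr_gt0 ?invr_gt0 ?exprn_gt0 //; lra.
exists (1 + c1); first by lra.
move=> n p p01 L1 mbar.
(* [ln] takes the value 0 at 0, so [1 <= ln n] excludes [n = 0]. *)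
have n0 : (0 < n)%N by case: n L1 {mbar} => // ; rewrite ln0 //; lra.
have n0' : 0 < n%:R :> R by rewrite ltr0n.
set L := ln n%:R in L1 mbar *.
set M := mean_size k n p in mbar *.
pose D : R := M / n%:R ^+ h.
have nh0 : 0 < n%:R ^+ h :> R by rewrite exprn_gt0.
have ME : M = D * n%:R ^+ h by rewrite /D mulfVK // gt_eqF.
have D1 : (1 + c1) * L <= D by rewrite /D ler_pdivlMr.
have c1L : 0 <= c1 * L by apply: mulr_ge0; lra.
have DL : L <= D by lra.
have D0 : 0 < D by lra.
have pf : p * (2 ^ k * n ^ h)%:R = D.
  rewrite /D /M /mean_size /k natrM !natrX !(exprD _ h h).
  by field; rewrite gt_eqF.
pose s := K * L; have s0 : 0 < s by rewrite mulr_gt0 //; lra.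
pose x := 3 * p * (2 ^ k * n ^ h)%:R + s.
pose y := 2 * (3 * p * (2 ^ k * n ^ h)%:R * (3 * p * (2 ^ k * n ^ h)%:R + s) + x * s).
have xE : x = 3 * D + s by rewrite /x -[3 * p * _]mulrA pf.
have xle : x <= (3 + K) * D.
  have : s <= K * D by rewrite /s; apply: ler_wpM2l => //; exact: ltW.
  by rewrite xE; lra.
have x0 : 0 <= x by rewrite xE; lra.
have [r /andP[Lr r3L]] := exists_pow2 L1.
have -> : (6 + 2 * (2 ^ k)%:R) / n%:R = (3 / n%:R + 3 / n%:R) + (2 ^ k)%:R * (2 / n%:R) :> R.
  by field; rewrite gt_eqF.
have cardh : #|{: {ffun 'I_h -> 'I_n}}| = (n ^ h)%N by rewrite card_ffun !card_ord.
apply: (all_two_sided_tail (good := even_good x y)) => //.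
- have side (key other : {ffun 'I_(h + h) -> 'I_n} -> {ffun 'I_h -> 'I_n}) :
      (forall t t', key t = key t' -> other t = other t' -> t = t') ->
      Pr p (fun J => ~~ scope_spread (fun=> tt) key x y J) <= 3 / n%:R.
    move=> ko; have fib u : (#|[pred C : constraint k n | key C.2 == u]| <= 2 ^ k * n ^ h)%N.
      by rewrite -cardh; exact: fiber_card ko.
    have fib1 (i : unit) u : (#|[pred C : constraint k n | (tt == i) && (key C.2 == u)]|
        <= 2 ^ k * n ^ h)%N by case: i; exact: fib.
    have := scope_spread_tail (base := fun=> tt) (key := key) p01 s0 fib1 fib (erefl x) (erefl y).
    move=> /le_trans; apply.
    apply: (spread_small n0 (k := k)) => //.
    rewrite cardh card_unit mul1n -expnD.
    by rewrite leq_add3 // leq_pexp2l // leq_addr.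
  apply: le_trans (lerD (side (@lefts h n) (@rights h n) _) (side (@rights h n) (@lefts h n) _)).
  + apply: Pr_union => // J; rewrite /even_good negb_and.
    by [].
  + exact: lefts_rights.
  + by move=> t t' *; exact: lefts_rights.
- move=> S i0 i0S.
  have l0 : 0 < eta * D by rewrite mulr_gt0.
  rewrite ME mulrA.
  apply: le_trans (even_tail p01 n i0S y r x0 l0) _.
  apply: (tail_small (k := k)) => //; first by rewrite leq_addr.
    by rewrite divr_ge0 ?sqr_ge0 // !mulr_ge0.
  rewrite expRN -/E ler_pdivrMr ?exprn_gt0 // [leRHS]mulrC ler_pdivlMr //.
  have s1 : 4 * (2 ^ r)%:R <= 12 * L by lra.
  apply: (@le_trans _ _ (12 * L * ((3 + K) * D * (2 ^ k)%:R) * E)).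
    apply: ler_wpM2r; first exact: ltW.
    apply: ler_pM => //; rewrite ?mulr_ge0 //.
    by apply: ler_wpM2r.
  have -> : 12 * L * ((3 + K) * D * (2 ^ k)%:R) * E = eta ^+ 2 * D * (c1 * L).
    by rewrite /c1; field; rewrite gt_eqF.
  rewrite exprMn [D ^+ 2]expr2 [leRHS]mulrA; apply: ler_wpM2l; last by lra.
  by rewrite mulr_ge0 ?sqr_ge0 // ltW.
Qed.

End Asymptotics.

Section OddAsymptotics.
Variable R : realType.

(** With [D = M / (n^h sqrt n)], row and flip bounds of order [D^2] and [D] face [lambda] of order
    [D^2], which again gives [ln n / D]. As [h > 0], also [M >= D n], so that [M^2 / n] dominates
    the diagonal. *)
Lemma all_two_sided_odd (h : nat) (eta : R) : (0 < h)%N -> 0 < eta ->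
  exists2 c : R, 0 < c & forall (n : nat) (p : R), 0 <= p <= 1 -> 1 <= ln n%:R :> R ->
    c * ln n%:R * (n%:R ^+ h * Num.sqrt n%:R) <= mean_size (h + h).+1 n p ->
    Pr p (fun J : {set constraint (h + h).+1 n} =>
            ~~ `[< all_two_sided (eta * mean_size (h + h).+1 n p) J >])
      <= (9 + 2 * (2 ^ (h + h).+1)%:R) / n%:R.
Proof.
move=> h0 eta0; set k := (h + h).+1%N; pose K : R := k.+1%:R.
pose E : R := expR k.+1%:R.
have E0 : 0 < E by exact: expR_gt0.
have K0 : 0 < K by rewrite ltr0n.
have pk0 : 0 < (2 ^ k)%:R :> R by rewrite ltr0n expn_gt0.
pose cy : R := 2 * (3 * (3 + K) + (3 + K) * K).
have cy0 : 0 < cy by rewrite /cy mulr_gt0 // addr_gt0 // !mulr_gt0 //; lra.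
pose c1 : R := 12 * (cy * (2 * (2 ^ k)%:R * (3 + K))) / (eta ^+ 2 / 2) ^+ 2 * E.
(* A lower bound on [M / n] under which the diagonal [2 ^ k m] stays below [eta^2 / 2] times
   [M^2 / n]. *)
pose c2 : R := (2 ^ k)%:R * (3 + K) / (eta ^+ 2 / 2).
have K3 : 0 < 3 + K by lra.
have e20 : 0 < eta ^+ 2 / 2 by rewrite divr_gt0 // exprn_gt0.
have c10 : 0 < c1.
  rewrite /c1; apply: mulr_gt0 => //; apply: divr_gt0; last by rewrite exprn_gt0.
  by rewrite !mulr_gt0 // addr_gt0 // mulr_gt0.
have c20 : 0 < c2 by rewrite /c2; apply: divr_gt0 => //; exact: mulr_gt0.
exists (1 + c1 + c2); first by lra.
move=> n p p01 L1 mbar.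
have n0 : (0 < n)%N by case: n L1 {mbar} => // ; rewrite ln0 //; lra.
have n0' : 0 < n%:R :> R by rewrite ltr0n.
set L := ln n%:R in L1 mbar *.
set M := mean_size k n p in mbar *.
set q := Num.sqrt n%:R in mbar.
have q1 : 1 <= q.
  by have := @ler_wsqrtr R 1 n%:R; rewrite sqrtr1; apply; rewrite ler1n.
have q0 : 0 < q by lra.
have q2 : n%:R = q ^+ 2 :> R by rewrite sqr_sqrtr.
have nh0 : 0 < n%:R ^+ h :> R by rewrite exprn_gt0.
have nq0 : 0 < n%:R ^+ h * q by exact: mulr_gt0.
pose D : R := M / (n%:R ^+ h * q).
have ME : M = D * (n%:R ^+ h * q) by rewrite /D mulfVK // gt_eqF.
have D1 : (1 + c1 + c2) * L <= D by rewrite /D ler_pdivlMr.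
have c1L : 0 <= c1 * L by apply: mulr_ge0; lra.
have c2L : c2 <= c2 * L by rewrite ler_pMr.
have DL : L <= D by lra.
have D0 : 0 < D by lra.
have nn : n%:R <= n%:R ^+ h * q.
  apply: (@le_trans _ _ (n%:R ^+ h)); last by rewrite ler_peMr // ltW.
  by rewrite -{1}[n%:R]expr1; apply: ler_weXn2l; rewrite ?ler1n.
have Mn : D * n%:R <= M by rewrite ME; apply: ler_wpM2l => //; exact: ltW.
have M0 : 0 < M by rewrite ME mulr_gt0.
(* Expected counts: [D / q] constraints with given middle variable and half, [D q] with given half.
   The factors [q = sqrt n] cancel in the product that governs [y]. *)
have pf1 : p * (2 ^ k * n ^ h)%:R = D / q.
  rewrite /D /M /mean_size /k natrM !natrX !exprS (exprD n%:R h h) {2}q2.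
  by field; rewrite !gt_eqF.
have pf0 : p * (2 ^ k * n ^ h.+1)%:R = D * q.
  rewrite /D /M /mean_size /k natrM !natrX !exprS (exprD n%:R h h).
  by field; rewrite !gt_eqF.
pose s := K * L; have s0 : 0 < s by rewrite mulr_gt0 //; lra.
have sD : s <= K * D by rewrite /s; apply: ler_wpM2l => //; exact: ltW.
pose x := 3 * p * (2 ^ k * n ^ h)%:R + s.
pose y := 2 * (3 * p * (2 ^ k * n ^ h)%:R * (3 * p * (2 ^ k * n ^ h.+1)%:R + s) + x * s).
have xE : x = 3 * (D / q) + s by rewrite /x -[3 * p * _]mulrA pf1.
have Dq : D / q <= D by rewrite ler_pdivrMr // ler_peMr // ltW.
have Dq0 : 0 <= D / q by rewrite divr_ge0 // ltW.
have xle : x <= (3 + K) * D by rewrite xE; lra.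
have x0 : 0 <= x by rewrite xE; lra.
have yE : y = 2 * (3 * (3 * D ^+ 2 + (D / q) * s) + x * s).
  rewrite /y -![3 * p * _]mulrA pf1 pf0; congr (2 * (_ + _)).
  by field; rewrite gt_eqF.
have yle : y <= cy * D ^+ 2.
  have h1 : (D / q) * s <= D * (K * D) by apply: ler_pM => //; exact: ltW.
  have h2 : x * s <= ((3 + K) * D) * (K * D) by apply: ler_pM => //; exact: ltW.
  by rewrite yE /cy expr2; lra.
have y0 : 0 <= y.
  have h1 : 0 <= (D / q) * s by apply: mulr_ge0 => //; exact: ltW.
  have h2 : 0 <= x * s by apply: mulr_ge0 => //; exact: ltW.
  by have := sqr_ge0 D; rewrite yE; lra.
pose m := 3 * M + s.
have mE : 3 * p * #|{: constraint k n}|%:R + s = m.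
  rewrite /m /M /mean_size card_prod !card_ffun card_bool !card_ord natrM !natrX.
  by ring.
have [r /andP[Lr r3L]] := exists_pow2 L1.
have -> : (9 + 2 * (2 ^ k)%:R) / n%:R
    = (3 / n%:R + (3 / n%:R + 3 / n%:R)) + (2 ^ k)%:R * (2 / n%:R) :> R.
  by field; rewrite gt_eqF.
have cardh : #|{: {ffun 'I_h -> 'I_n}}| = (n ^ h)%N by rewrite card_ffun !card_ord.
apply: (all_two_sided_tail (good := odd_good m x y)) => //.
- have side (key other : {ffun 'I_k -> 'I_n} -> {ffun 'I_h -> 'I_n}) :
      (forall t t', mid t = mid t' -> key t = key t' -> other t = other t' -> t = t') ->
      Pr p (fun J => ~~ scope_spread (@mid h n) key x y J) <= 3 / n%:R.
    move=> ko.
    have fib1 i u : (#|[pred C : constraint k n | (mid C.2 == i) && (key C.2 == u)]|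
        <= 2 ^ k * n ^ h)%N.
      rewrite -cardh; have := @fiber_card k n _ _ (fun t => (mid t, key t)) other (i, u).
      by apply => t t' [] *; exact: ko.
    have fib0 u : (#|[pred C : constraint k n | key C.2 == u]| <= 2 ^ k * n ^ h.+1)%N.
      have := @fiber_card k n _ _ key (fun t => (mid t, other t)) u.
      rewrite card_prod cardh card_ord -expnS; apply => t t' kt [] *; exact: ko.
    have := scope_spread_tail (base := @mid h n) (key := key) p01 s0 fib1 fib0
      (erefl x) (erefl y).
    move=> /le_trans; apply.
    apply: (spread_small n0 (k := k)) => //.
    rewrite cardh card_ord -expnD -expnS.
    apply: leq_add3; apply: leq_pexp2l; rewrite ?n0 // /k.
    - by rewrite ltnS leq_addr.
    - by apply: leq_trans (leqnSn _); rewrite leq_addr.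
  have sz : Pr p (fun J : {set constraint k n} => ~~ (#|J|%:R <= m)) <= 3 / n%:R.
    apply: le_trans (_ : 1%:R * expR (- s) <= _); last first.
      apply: (spread_small n0 (k := k)) => //.
      by rewrite muln_gt0 expn_gt0 n0.
    rewrite mul1r; apply: le_trans (count_tail p01 predT s); apply: Pr_mono => // J.
    rewrite -ltNge -mE.
    have -> : count predT J = #|J| by apply: eq_card => C; rewrite !inE andbT.
    by [].
  have both := lerD (side (@part1 h n) (@part2 h n) (@parts_inj h n))
    (side (@part2 h n) (@part1 h n) (fun t t' m2 l2 r2 => parts_inj m2 r2 l2)).
  apply: le_trans (lerD sz both).
  apply: (@le_trans _ _ (Pr p (fun J : {set constraint k n} => ~~ (#|J|%:R <= m)) +
    Pr p (fun J => ~~ (scope_spread (@mid h n) (@part1 h n) x y J &&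
                       scope_spread (@mid h n) (@part2 h n) x y J)))).
    by apply: Pr_union => // J; rewrite /odd_good -negb_and.
  by rewrite lerD2l; apply: Pr_union => // J; rewrite negb_and.
- move=> S i0 i0S.
  (* [lambda] grants the off-diagonal part the same share [eta^2 / 2] of [M^2 / n] as the diagonal,
     and [mu] balances the two terms of [b], each at most [eta M / 2]. *)
  pose lambda := eta ^+ 2 / 2 * D ^+ 2; pose mu := eta * M / n%:R.
  have l0 : 0 < lambda by rewrite /lambda mulr_gt0 // exprn_gt0.
  have mu0 : 0 < mu by rewrite /mu divr_gt0 // mulr_gt0.
  pose b := mu / 2 * n%:R + (2 * mu)^-1 * ((2 ^ k)%:R * m + lambda * n%:R ^+ (h + h)).
  have bM : b <= eta * M.
    have lamE : lambda * n%:R ^+ (h + h) = eta ^+ 2 / 2 * (M ^+ 2 / n%:R).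
      rewrite /lambda ME !exprMn exprD -q2.
      by field; rewrite !gt_eqF.
    have mle : (2 ^ k)%:R * m <= eta ^+ 2 / 2 * (M ^+ 2 / n%:R).
      have LM : s <= K * M.
        apply: le_trans sD _; apply: ler_wpM2l; first exact: ltW.
        by apply: le_trans Mn; rewrite ler_peMr ?ler1n // ltW.
      have c2M : c2 <= M / n%:R.
        rewrite ler_pdivlMr //; apply: le_trans Mn; apply: ler_wpM2r => //; lra.
      have -> : eta ^+ 2 / 2 * (M ^+ 2 / n%:R) = eta ^+ 2 / 2 * (M / n%:R) * M.
        by field; rewrite gt_eqF.
      apply: (@le_trans _ _ (eta ^+ 2 / 2 * c2 * M)).
        have -> : eta ^+ 2 / 2 * c2 = (2 ^ k)%:R * (3 + K).
          by rewrite /c2 mulrC mulfVK // gt_eqF.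
        rewrite -mulrA; apply: ler_wpM2l => //; rewrite /m; lra.
      apply: ler_wpM2r; first exact: ltW.
      by apply: ler_wpM2l => //; exact: ltW.
    rewrite /b lamE.
    apply: (@le_trans _ _ (mu / 2 * n%:R + (2 * mu)^-1 *
       (eta ^+ 2 / 2 * (M ^+ 2 / n%:R) + eta ^+ 2 / 2 * (M ^+ 2 / n%:R)))).
      rewrite lerD2l; apply: ler_wpM2l; first by rewrite invr_ge0 mulr_ge0 // ltW.
      by rewrite lerD2r.
    rewrite le_eqVlt; apply/orP; left; apply/eqP; rewrite /mu.
    by field; rewrite !gt_eqF.
  apply: (@le_trans _ _ (Pr p (fun J => odd_good m x y J &&
      ~~ `[< two_sided (2 * k) S J b >]))).
    apply: Pr_mono => // J /andP[-> /asboolP nc] /=; apply/asboolP => c.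
    exact/nc/(two_sided_mono bM c).
  apply: le_trans (odd_tail p01 n i0S m r x0 y0 l0 mu0) _.
  apply: (tail_small (k := k)) => //.
    apply: divr_ge0; last exact: sqr_ge0.
    by apply: mulr_ge0 => //; do 2!apply: mulr_ge0 => //.
  rewrite expRN -/E ler_pdivrMr ?exprn_gt0 // [leRHS]mulrC ler_pdivlMr //.
  have s1 : 4 * (2 ^ r)%:R <= 12 * L by lra.
  apply: (@le_trans _ _ (12 * L * (cy * D ^+ 2 * (2 * (2 ^ k)%:R * ((3 + K) * D))) * E)).
    apply: ler_wpM2r; first exact: ltW.
    have x2 : 0 <= 2 * (2 ^ k)%:R * x by apply: mulr_ge0.
    apply: ler_pM; [by rewrite mulr_ge0|exact: mulr_ge0|exact: s1|].
    by apply: ler_pM => //; apply: ler_wpM2l.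
  have -> : 12 * L * (cy * D ^+ 2 * (2 * (2 ^ k)%:R * ((3 + K) * D))) * E
      = (eta ^+ 2 / 2) ^+ 2 * D ^+ 3 * (c1 * L).
    by rewrite /c1; field; rewrite gt_eqF.
  have -> : lambda ^+ 2 = (eta ^+ 2 / 2) ^+ 2 * D ^+ 3 * D by rewrite /lambda; ring.
  apply: ler_wpM2l; last by lra.
  by rewrite mulr_ge0 ?sqr_ge0 // exprn_ge0 // ltW.
Qed.

End OddAsymptotics.

(** * From signed polynomials to the value of the instance *)

Section Refutation.
Variable R : realType.

Lemma fourier_set0 k (P : cube k -> bool) : fourier R P finset.set0 = mean R P.
Proof.
rewrite /fourier /mean /expect_cube; congr (_ * _); apply: eq_bigr => z _.
by rewrite /chi big_set0 mulr1.
Qed.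

Lemma fourier_le1 k (P : cube k -> bool) (S : {set 'I_k}) : `|fourier R P S| <= 1.
Proof.
have two0 : 0 < 2 ^+ k :> R by rewrite exprn_gt0.
rewrite /fourier /expect_cube normrM normfV (ger0_norm (ltW two0)).
rewrite ler_pdivrMl // mulr1; apply: le_trans (ler_norm_sum _ _ _) _.
apply: (@le_trans _ _ (\sum_(z : cube k) 1)).
  apply: ler_sum => z _; rewrite normrM normr_chi mulr1.
  by case: (P z); rewrite ?normr1 ?normr0 ?ler01.
by rewrite sumr_const card_ffun card_bool card_ord natrX.
Qed.

(** The empty set contributes exactly the mean. Each other [S] costs at most [gamma b / 2 ^ k], as
    Fourier coefficients are at most 1 in absolute value, and dividing by the size, at least [b],
    leaves at most [gamma]. *)
Lemma refute (k n : nat) (P : cube k -> bool) (gamma b : R) (J : {set constraint k n}) :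
  0 < gamma -> 0 < b -> b <= #|J|%:R ->
  all_two_sided (gamma / (2 ^ k)%:R * b) J ->
  sos_proves_le_on_box (2 * k) (val_poly R P (enum J)) (mconst n (mean R P + gamma)).
Proof.
move=> g0 b0 bJ two.
have J0 : 0 < #|J|%:R :> R by lra.
have pk0 : 0 < (2 ^ k)%:R :> R by rewrite ltr0n expn_gt0.
pose eta := gamma / (2 ^ k)%:R * b; pose m : R := #|J|%:R.
pose f := fourier R P.
have valE : val_poly R P (enum J) =
    mconst n (mean R P) + m^-1 *: \sum_(S | S != finset.set0) f S *: signed_poly R S J.
  rewrite /val_poly -cardE big_enum exchange_big /= (bigD1 finset.set0) //= scalerDr.
  congr (_ + _).
    under eq_bigr => C _ do rewrite big_set0 /chi big_set0 mulr1 fourier_set0.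
    rewrite sumr_const -scalerMnr scalerA scalerMnl -mulr_natr mulrAC mulVf ?gt_eqF // mul1r.
    by rewrite alg_mpolyC.
  congr (_ *: _); apply: eq_bigr => S _; rewrite /signed_poly scaler_sumr.
  by apply: eq_bigr => C _; rewrite scalerA.
have term S : S != finset.set0 ->
    box_cone (2 * k) (mconst n (`|f S| * eta) - f S *: signed_poly R S J).
  move=> S0; have [c1 c2] := two S S0.
  have fE a : mconst n (`|f S| * a) = `|f S| *: mconst n a.
    by rewrite -mul_mpolyC -rmorphM.
  have [f0|f0] := leP 0 (f S).
    by rewrite fE ger0_norm // -scalerBr; exact: box_coneZ.
  rewrite fE ltr0_norm // -[X in _ + X]scaleNr -scalerDr.
  by apply: box_coneZ c2; rewrite oppr_ge0 ltW.
have cS := box_cone_sum (index_enum {set 'I_k}) term.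
rewrite /sos_proves_le_on_box -/(box_cone _ _) valE.
have m0 : 0 <= m^-1 by rewrite invr_ge0.
pose s := \sum_(S | S != finset.set0) `|f S| * eta.
have sE : \sum_(S | S != finset.set0) mconst n (`|f S| * eta) = mconst n s.
  by rewrite /s /mconst rmorph_sum.
have sle : m^-1 * s <= gamma.
  rewrite mulrC ler_pdivrMr //; apply: (@le_trans _ _ (gamma * b)); last first.
    by apply: ler_wpM2l => //; exact: ltW.
  have e0 : 0 <= eta by rewrite /eta mulr_ge0 ?divr_ge0 // ltW.
  apply: (@le_trans _ _ (\sum_(S : {set 'I_k}) eta)).
    rewrite /s big_mkcond; apply: ler_sum => S _; case: ifP => // _.
    by rewrite ler_piMl // fourier_le1.
  rewrite sumr_const card_ord_sets.
  by rewrite -[leLHS]mulr_natl /eta mulrA [(2 ^ k)%:R * _]mulrC mulfVK ?gt_eqF.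
have := box_coneD (box_coneZ m0 cS) (box_coneC n (2 * k) (_ : 0 <= gamma - m^-1 * s)).
rewrite subr_ge0 => /(_ sle); congr box_cone.
rewrite sumrB sE scalerBr -[m^-1 *: mconst n s]mul_mpolyC /mconst -rmorphM /=.
rewrite rmorphB rmorphD /= [in RHS]opprD.
by ring.
Qed.

End Refutation.

Theorem theorem6p5 (R : realType) :
  exists C : nat,
    forall (k : nat) (P : cube k -> bool) (gamma : R) (p : nat -> R),
      (2 <= k)%N ->
      0 < gamma ->
      (forall n, 0 <= p n <= 1) ->
      (\forall n \near \oo,
         2 ^+ (C * k) * n%:R `^ (k%:R / 2) * ln n%:R ^+ 5 / gamma ^+ 2
           <= mean_size k n (p n)) ->
      csp_prob (p n) (fun I : instance k n =>
          sos_proves_le_on_box (2 * k) (val_poly R P I)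
            (mconst n (mean R P + gamma)))
        @[n --> \oo] --> (1 : R).
Proof.
(* [k] and [gamma] stay fixed as [n] grows, so [ln n ^ 4] eventually exceeds every constant
   depending on them, including the power of 2. *)
exists 0%N => k P gamma p k2 g0 p01 hm.
have pk0 : 0 < (2 ^ k)%:R :> R by rewrite ltr0n expn_gt0.
(* [2 ^ k] shares [gamma] among the sets [S]; the 4 makes up for knowing only that the size is at
   least [M / 4]. *)
pose eta := gamma / (2 ^ k)%:R / 4.
have eta0 : 0 < eta by rewrite /eta !divr_gt0.
have [c c0 tail] : exists2 c : R, 0 < c & forall (n : nat) (q : R), 0 <= q <= 1 ->
    1 <= ln n%:R :> R -> c * ln n%:R * n%:R `^ (k%:R / 2) <= mean_size k n q ->
    Pr q (fun J : {set constraint k n} => ~~ `[< all_two_sided (eta * mean_size k n q) J >])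
      <= (9 + 2 * (2 ^ k)%:R) / n%:R.
  have [kodd|keven] := boolP (odd k).
    have [h kE] : exists h, k = (h + h).+1.
      by exists k./2; rewrite -[LHS]odd_double_half kodd addnn.
    have h0 : (0 < h)%N by move: k2; rewrite kE; case: h {kE}.
    have [c c0 hc] := all_two_sided_odd h0 eta0.
    exists c => // n q q01 L1 mn; rewrite kE in mn *; apply: hc => //.
    apply: le_trans mn; rewrite le_eqVlt; apply/orP; left; apply/eqP; congr (_ * _).
    have n0 : n%:R != 0 :> R.
      by case: n L1 => [|n _]; rewrite ?ln0 ?pnatr_eq0 //; lra.
    have -> : (h + h).+1%:R / 2 = h%:R + 2^-1 :> R.
      by rewrite -addn1 !natrD; field.
    by rewrite powRD ?n0 ?implybT // powR_mulrn // -powR12_sqrt.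
  have [h kE] : exists h, k = (h + h)%N.
    by exists k./2; rewrite -[LHS]odd_double_half (negbTE keven) addnn.
  have [c c0 hc] := all_two_sided_even h eta0.
  exists c => // n q q01 L1 mn; rewrite kE in mn *.
  apply: le_trans (hc n q q01 L1 _) _.
    apply: le_trans mn; rewrite le_eqVlt; apply/orP; left; apply/eqP; congr (_ * _).
    have -> : (h + h)%:R / 2 = h%:R :> R by rewrite natrD; field.
    by rewrite powR_mulrn.
  by apply: ler_wpM2r; rewrite ?invr_ge0 // lerD2r ler_nat.
pose A : R := 10 + 2 * (2 ^ k)%:R.
pose ev n (I : instance k n) := sos_proves_le_on_box (2 * k) (val_poly R P I)
  (mconst n (mean R P + gamma)).
have probE n : csp_prob (p n) (@ev n) = Pr (p n) (fun J => `[< ev n (enum J) >]).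
  by [].
have upper n : csp_prob (p n) (@ev n) <= 1.
  rewrite probE Pr_compl //; have := Pr_ge0 (p01 n)
    (predC (fun J : {set constraint k n} => `[< ev n (enum J) >])); lra.
have lower : \forall n \near \oo, 1 - A / n%:R <= csp_prob (p n) (@ev n).
  near=> n.
  have n1 : (1 <= n)%N by near: n; exact: nbhs_infty_ge.
  have n0 : 0 < n%:R :> R by rewrite ltr0n.
  (* The three terms give [ln n >= 1], the constant [c] asked by [tail], and [M / 4 >= ln n], so
     that too small an instance has probability at most [1 / n]. *)
  pose B : R := 1 + c * gamma ^+ 2 + 4 * gamma ^+ 2.
  have LB : B <= ln n%:R.
    rewrite -[B]expRK ler_ln ?posrE ?expR_gt0 //.
    by near: n; exact: nbhs_infty_ger.
  set L := ln n%:R in LB.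
  have g20 : 0 < gamma ^+ 2 by rewrite exprn_gt0.
  have cg : 0 < c * gamma ^+ 2 by exact: mulr_gt0.
  have L1 : 1 <= L by rewrite /B in LB; lra.
  have pw1 : 1 <= n%:R `^ (k%:R / 2) :> R.
    by rewrite -[leLHS](powRr0 n%:R) ler_powR ?ler1n.
  have L4 : B <= L ^+ 4.
    apply: le_trans LB _; rewrite -[leLHS]expr1; exact: ler_weXn2l.
  have mn : B * L * n%:R `^ (k%:R / 2) / gamma ^+ 2 <= mean_size k n (p n).
    have hn : 2 ^+ (0 * k) * n%:R `^ (k%:R / 2) * ln n%:R ^+ 5 / gamma ^+ 2
           <= mean_size k n (p n) by near: n.
    apply: le_trans hn; rewrite mul0n expr0 mul1r -/L.
    apply: ler_wpM2r; first by rewrite invr_ge0 sqr_ge0.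
    rewrite [leRHS]mulrC; apply: ler_wpM2r; first by lra.
    by rewrite exprSr; apply: ler_wpM2r => //; lra.
  set w := n%:R `^ (k%:R / 2) in mn pw1.
  have Lw : 0 < L * w by rewrite mulr_gt0; lra.
  have mn' : (c + 4) * (L * w) <= mean_size k n (p n).
    apply: le_trans mn.
    have -> : B * L * w / gamma ^+ 2 = B / gamma ^+ 2 * (L * w) by ring.
    apply: ler_wpM2r; first exact: ltW.
    by rewrite ler_pdivlMr // /B; lra.
  set M := mean_size k n (p n) in mn'.
  have M4 : L <= M / 4.
    have : L * 1 <= L * w by apply: ler_wpM2l; lra.
    have : 0 <= c * (L * w) by rewrite mulr_ge0 // ltW.
    by move: mn'; lra.
  have M0 : 0 < M / 4 by lra.
  have ME : p n * #|{: constraint k n}|%:R = M.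
    rewrite /M /mean_size card_prod !card_ffun card_bool !card_ord natrM !natrX.
    by ring.
  have size_small : Pr (p n) (fun J : {set constraint k n} => #|J|%:R < M / 4) <= n%:R^-1.
    have := size_lower_tail (constraint k n) (p01 n); rewrite ME => /le_trans; apply.
    by rewrite -[leRHS]lnK ?posrE ?invr_gt0 // ler_expR lnV ?posrE // lerN2.
  have rest := tail n (p n) (p01 n) L1 _.
  have fail : Pr (p n) (predC (fun J : {set constraint k n} => `[< ev n (enum J) >]))
      <= n%:R^-1 + (9 + 2 * (2 ^ k)%:R) / n%:R.
    apply: le_trans (lerD size_small (rest _)); last first.
      by apply: le_trans mn'; rewrite -mulrA; apply: ler_wpM2r; [exact: ltW|lra].
    apply: Pr_union => // J /= /asboolP nev; case: ltP => //= MJ.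
    apply/asboolP => two; apply: nev; apply: refute MJ _ => //.
    suff -> : gamma / (2 ^ k)%:R * (M / 4) = eta * M by [].
    by rewrite /eta; ring.
  rewrite probE Pr_compl //; move: fail.
  have -> : A / n%:R = n%:R^-1 + (9 + 2 * (2 ^ k)%:R) / n%:R by rewrite /A; field; rewrite gt_eqF.
  lra.
apply: (@squeeze_cvgr _ _ _ _ (fun n => 1 - A / n%:R) (fun=> 1)).
- by near=> n; rewrite upper andbT; near: n.
- rewrite -[X in _ --> X]subr0; apply: cvgB; first exact: cvg_cst.
  rewrite -(mulr0 A); apply: cvgM; first exact: cvg_cst.
  (* The harmonic sequence is [1 / (n + 1)], hence the shift. *)
  by rewrite -cvg_shiftS; exact: cvg_harmonic.
- exact: cvg_cst.
Unshelve. all: by end_near.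
Qed.
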